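(* Let $0<\alpha<1$, $\varepsilon>0$, $M>0$, $S\ge 0$, and let $0=t_0<t_1<\dots<t_N=T$ be an arbitrary (possibly non-uniform) temporal grid with steps $\tau_k=t_k-t_{k-1}$. Let $\phi^0$ be given and set $r^{-\frac12}=(\phi^0)^2-1-S$. Let $(\phi^{n+1},\mu^{n+\frac12},r^{n+\frac12})$, $0\le n\le N-1$, satisfy the $L1^+$ linear relaxation scheme for the time-fractional Allen-Cahn equation on $\Omega$, with periodic or homogeneous Neumann boundary conditions: for $0\le n\le N-1$, $$\partial_\tau^\alpha \phi^{n+\frac12} = -M\mu^{n+\frac12},$$ $$\mu^{n+\frac12} = -\varepsilon^2\Delta\phi^{n+\frac12}+\left(r^{n+\frac12}+S\right)\phi^{n+\frac12},$$ $$\frac{r^{n+\frac12}+r^{n-\frac12}}{2}=\left(\phi^n\right)^2-1-S,$$ where $\phi^{n+\frac12}=\frac{\phi^{n+1}+\phi^n}{2}$ and $\partial_\tau^\alpha\phi^{n+\frac12}$ is the $L1^+$ discrete Caputo derivative. Then for every $0\le n\le N-1$, $$\tilde E\left(\phi^{n+1},r^{n+\frac12}\right)\le \tilde E\left(\phi^0,r^{-\frac12}\right)=E\left(\phi^0\right),$$ where $$\tilde E(\phi^{n+1},r^{n+\frac12})=\int_\Omega\left(\frac{\varepsilon^2}{2}|\nabla\phi^{n+1}|^2+\frac12\left(r^{n+\frac12}+S\right)\left((\phi^{n+1})^2-1-S\right)-\frac14\left(r^{n+\frac12}\right)^2\right)d\mathbf{x}+\frac{S^2}{4}|\Omega|.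$$
   Context: $\Omega$ is a bounded spatial domain (a box in the periodic case) with volume $|\Omega|$. Time is discretized and space is left continuous: $\phi^n$, $\mu^{n+\frac12}$, $r^{n+\frac12}$ are real-valued functions on $\Omega$, assumed regular enough for the scheme, the integrals and the integrations by parts to make sense, with $\phi^n$ satisfying either periodic boundary conditions or homogeneous Neumann boundary conditions ($\partial_{\mathbf n}\phi^n=0$ on $\partial\Omega$). The functions $\mu^{n+\frac12}$ and $r^{n+\frac12}$ are unknowns at the midpoint $t_{n+\frac12}$; $r^{n+\frac12}$ is a staggered-grid unknown determined by the third equation of the scheme, not an average. The $L1^+$ discrete Caputo derivative: for $n\ge1$, $$\partial_\tau^\alpha u^{n-\frac12}=(\partial_\tau^\alpha u)^{n-\frac12}:=\sum_{k=1}^n b^{(n)}_{n-k}\,\nabla_\tau u^k,\qquad \nabla_\tau u^k=u^k-u^{k-1},$$ $$b^{(n)}_{n-k}=\frac{1}{\Gamma(1-\alpha)\,\tau_n\tau_k}\int_{t_{n-1}}^{t_n}\int_{t_{k-1}}^{\min\{t_k,t\}}(t-s)^{-\alpha}\,ds\,dt,$$ with $\Gamma$ the gamma function; $\partial_\tau^\alpha\phi^{n+\frac12}$ is this expression with $n$ replaced by $n+1$ and $u=\phi$. The original free energy is $E(\phi)=\int_\Omega\left(\frac{\varepsilon^2}{2}|\nabla\phi|^2+\frac14(\phi^2-1)^2\right)d\mathbf{x}$. The modified energy at the initial level, $\tilde E(\phi^0,r^{-\frac12})$, is given by the same formula as $\tilde E(\phi^{n+1},r^{n+\frac12})$ with $(\phi^{n+1},r^{n+\frac12})$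 replaced by $(\phi^0,r^{-\frac12})$. *)

(* Defs.v *)
From HB Require Import structures.
From mathcomp Require Import all_boot all_order all_algebra.
From mathcomp Require Import all_classical all_reals all_analysis.

Set Implicit Arguments.
Unset Strict Implicit.
Unset Printing Implicit Defensive.

Import Order.TTheory GRing.Theory Num.Theory.
Import numFieldNormedType.Exports.

Local Open Scope classical_set_scope.
Local Open Scope ring_scope.

(* Lebesgue measure on [d.-tuple R], by iterating the binary product measure
   along the isomorphism R * R^d -> R^(d+1).  The vector space structure and
   the topology live on ['rV[R]_d] and the sigma-algebra on [d.-tuple R]; the
   two are identified by [vec]. *)
Section cons_measure.
Context {R : realType} (d : nat).
Local Notation T := (measurableTypeR R).
Variable m : {sigma_finite_measure set (d.-tuple T) -> \bar R}.

Definition cons_tup (p : T * d.-tuple T) : d.+1.-tuple T :=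
  [tuple of p.1 :: p.2].

Lemma measurable_cons_tup : measurable_fun [set: T * d.-tuple T] cons_tup.
Proof. by apply: measurable_cons. Qed.

Definition cons_measure : set (d.+1.-tuple T) -> \bar R :=
  pushforward (@lebesgue_measure R \x m)%E cons_tup.

Let cons_measure0 : cons_measure set0 = 0%E.
Proof. by rewrite /cons_measure /pushforward preimage_set0 measure0. Qed.

Let cons_measure_ge0 A : (0 <= cons_measure A)%E.
Proof. by rewrite /cons_measure /pushforward; exact: measure_ge0. Qed.

Let cons_measure_sigma_additive : semi_sigma_additive cons_measure.
Proof.
move=> F mF tF mUF; rewrite /cons_measure /pushforward preimage_bigcup.
apply: measure_semi_sigma_additive.
- by move=> n; rewrite -[X in measurable X]setTI; exact: measurable_cons_tup.
- apply/trivIsetP => /= i j _ _ ij; rewrite -preimage_setI.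
  by move/trivIsetP : tF => /(_ _ _ _ _ ij) ->//; rewrite preimage_set0.
- rewrite -preimage_bigcup -[X in measurable X]setTI.
  exact: measurable_cons_tup.
Qed.

HB.instance Definition _ := isMeasure.Build _ _ _ cons_measure
  cons_measure0 cons_measure_ge0 cons_measure_sigma_additive.

Let uncons (u : d.+1.-tuple T) : T * d.-tuple T :=
  (thead u, [tuple of behead u]).

Let cons_tupK : cancel cons_tup uncons.
Proof. by move=> [x u]; rewrite /uncons theadE; congr pair; exact/val_inj. Qed.

Lemma cons_measure_sigma_finite : sigma_finite setT cons_measure.
Proof.
have /sigma_finiteP[F [TF ndF Foo]] := sigma_finiteT (@lebesgue_measure R).
have /sigma_finiteP[G [TG ndG Goo]] := sigma_finiteT m.
exists (fun n => uncons @^-1` (F n `*` G n)).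
  rewrite -preimage_bigcup (_ : \bigcup_n _ = setT) ?preimage_setT//.
  rewrite -setXTT TF TG predeqE => -[x y]; split.
    by move=> [n _ []/= ? ?]; split; exists n.
  move=> [/= [n _ Fnx] [k _ Gky]]; exists (maxn n k) => //; split.
  - by move: x Fnx; exact/subsetPset/ndF/leq_maxl.
  - by move: y Gky; exact/subsetPset/ndG/leq_maxr.
move=> n; have [mF Fn] := Foo n; have [mG Gn] := Goo n; split.
  rewrite -[X in measurable X]setTI.
  apply: measurable_fun_pair => //; last exact: measurableX.
  - exact: measurable_tnth.
  - exact: measurable_behead.
rewrite /cons_measure /pushforward -comp_preimage (_ : uncons \o _ = id); last first.
  by apply/funext => p /=; exact: cons_tupK.
by rewrite preimage_id product_measure1E// lte_mul_pinfty// ge0_fin_numE.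
Qed.

HB.instance Definition _ := Measure_isSigmaFinite.Build _ _ _
  cons_measure cons_measure_sigma_finite.

End cons_measure.

Fixpoint lebesgue_tuple {R : realType} (d : nat) :
    {sigma_finite_measure set (d.-tuple (measurableTypeR R)) -> \bar R} :=
  if d is d'.+1 then cons_measure (lebesgue_tuple d')
  else \d_([tuple] : 0.-tuple (measurableTypeR R)).

Lemma lebesgue_tuple_box {R : realType} (d : nat)
    (A : 'I_d -> set (measurableTypeR R)) :
  (forall i, measurable (A i)) ->
  lebesgue_tuple d [set u | forall i, A i (tnth u i)] =
  (\prod_(i < d) lebesgue_measure (A i))%E.
Proof.
elim: d A => [|d IH] A mA.
  by rewrite big_ord0 /= diracE mem_set// => -[].
rewrite big_ord_recl -IH// /= /cons_measure /pushforward.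
have -> : @cons_tup R d @^-1` [set u | forall i, A i (tnth u i)] =
    A ord0 `*` [set u : d.-tuple _ | forall i, A (lift ord0 i) (tnth u i)].
  apply/seteqP; split=> -[x u] /=.
    move=> H; split; first exact: (H ord0).
    by move=> i; have := H (lift ord0 i); rewrite tnthS.
  move=> [A0 AS] i; case: (unliftP ord0 i) => [j ->|->//].
  by rewrite tnthS; exact: AS.
rewrite product_measure1E//.
rewrite (_ : [set u | _] = \bigcap_(i : 'I_d)
  ((fun u : d.-tuple (measurableTypeR R) => tnth u i) @^-1` A (lift ord0 i))).
  apply: fin_bigcap_measurable => // i _.
  by rewrite -[X in measurable X]setTI; exact: measurable_tnth.
by apply/seteqP; split=> [u H i _|u H i]; [exact: H|exact: (H i I)].
Qed.

Section euclidean.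
Context {R : realType} {d : nat}.
Implicit Types (Omega : set 'rV[R]_d) (f g : 'rV[R]_d -> R).

Definition vec (u : d.-tuple (measurableTypeR R)) : 'rV[R]_d :=
  \row_i tnth u i.

Definition integral_on Omega f : R :=
  \int[lebesgue_tuple d]_(u in vec @^-1` Omega) f (vec u).

Definition volume Omega : R := fine (lebesgue_tuple d (vec @^-1` Omega)).

Definition partial (i : 'I_d) f : 'rV[R]_d -> R :=
  fun x => 'D_(delta_mx 0 i) f x.

Definition grad_sqr f : 'rV[R]_d -> R := fun x => \sum_i partial i f x ^+ 2.

Definition laplacian f : 'rV[R]_d -> R :=
  fun x => \sum_i partial i (partial i f) x.

Definition bounded_domain Omega :=
  [/\ open Omega, Omega !=set0, connected Omega & bounded_set Omega].

(* The partial derivatives of [f] are only used inside [Omega]; on the boundary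
   their values are those of the continuous extension. *)
Definition extends_continuously Omega f :=
  exists2 h : 'rV[R]_d -> R, {within closure Omega, continuous h} &
    forall x, Omega x -> h x = f x.

Definition C1_closure Omega f :=
  extends_continuously Omega f /\
  forall i, (forall x, Omega x -> derivable f x (delta_mx 0 i)) /\
            extends_continuously Omega (partial i f).

Definition C2_closure Omega f :=
  C1_closure Omega f /\ forall i, C1_closure Omega (partial i f).

Definition open_box (a b : 'rV[R]_d) : set 'rV[R]_d :=
  [set x | forall i, a 0 i < x 0 i < b 0 i].

Definition box_periodic (a b : 'rV[R]_d) f :=
  forall i x, f (x + (b 0 i - a 0 i) *: delta_mx 0 i) = f x.

Definition boundary Omega := closure Omega `\` Omega.

(* [sigma] and [nu] are the surface measure and the outward unit normal of
   [Omega]: by Riesz representation, the divergence theorem determines the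
   restriction of [sigma] to the boundary and, sigma-almost everywhere, the unit
   field [nu].  Domains with corners (a box, a Lipschitz domain) are
   included, [nu] being arbitrary on a sigma-null set. *)
Definition surface_measure_normal Omega
    (sigma : {finite_measure set (d.-tuple (measurableTypeR R)) -> \bar R})
    (nu : 'rV[R]_d -> 'rV[R]_d) :=
  [/\ forall i, measurable_fun (vec @^-1` boundary Omega)
        (fun u => nu (vec u) 0 i),
      forall x, boundary Omega x -> \sum_i nu x 0 i ^+ 2 = 1 &
      forall F : 'I_d -> 'rV[R]_d -> R,
        (forall i, {within closure Omega, continuous (F i)} /\
                   C1_closure Omega (F i)) ->
        integral_on Omega (fun x => \sum_i partial i (F i) x) =
        \int[sigma]_(u in vec @^-1` boundary Omega)
          \sum_i F i (vec u) * nu (vec u) 0 i ].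

(* Normal derivative at the boundary point [x], as the limit from inside
   [Omega] of the directional derivative along [nu x]. *)
Definition normal_derivative_is0 Omega (nu : 'rV[R]_d -> 'rV[R]_d) f x :=
  (fun y => \sum_i partial i f y * nu x 0 i) @ within Omega (nbhs x) --> (0 : R).

Definition periodic_bc Omega (N : nat) (phi : nat -> 'rV[R]_d -> R) :=
  exists a b : 'rV[R]_d,
    [/\ forall i, a 0 i < b 0 i, Omega = open_box a b &
        forall n, (n <= N)%N ->
          C2_closure [set: 'rV[R]_d] (phi n) /\ box_periodic a b (phi n)].

Definition neumann_bc Omega (N : nat) (phi : nat -> 'rV[R]_d -> R) :=
  exists (sigma : {finite_measure set (d.-tuple (measurableTypeR R)) -> \bar R})
         (nu : 'rV[R]_d -> 'rV[R]_d),
    surface_measure_normal Omega sigma nu /\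
    forall n, (n <= N)%N ->
      C2_closure Omega (phi n) /\
      {ae sigma, forall u, boundary Omega (vec u) ->
                           normal_derivative_is0 Omega nu (phi n) (vec u)}.

End euclidean.

Section L1plus.
Context {R : realType}.
Implicit Types (alpha : R) (t u : nat -> R).
Local Notation mu := (@lebesgue_measure R).

Definition Gamma (a : R) : R :=
  \int[mu]_(x in `]0, +oo[) (x `^ (a - 1) * expR (- x)).

Definition tau t k : R := t k - t k.-1.

(* [L1plus_coef alpha t n k] is $b^{(n)}_{n-k}$, for $1 \le k \le n$. *)
Definition L1plus_coef alpha t (n k : nat) : R :=
  (Gamma (1 - alpha) * tau t n * tau t k)^-1 *
  \int[mu]_(x in `[t n.-1, t n])
    \int[mu]_(s in `[t k.-1, Num.min (t k) x]) ((x - s) `^ (- alpha)).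

(* $(\partial_\tau^\alpha u)^{n-1/2}$, for $n \ge 1$. *)
Definition L1plus_caputo alpha t u (n : nat) : R :=
  \sum_(1 <= k < n.+1) L1plus_coef alpha t n k * (u k - u k.-1).

End L1plus.

Section energy.
Context {R : realType} {d : nat}.
Implicit Types (Omega : set 'rV[R]_d) (phi r : 'rV[R]_d -> R).

Definition energy (eps : R) Omega phi : R :=
  integral_on Omega (fun x =>
    eps ^+ 2 / 2 * grad_sqr phi x + 1 / 4 * (phi x ^+ 2 - 1) ^+ 2).

Definition modified_energy (eps S : R) Omega phi r : R :=
  integral_on Omega (fun x =>
    eps ^+ 2 / 2 * grad_sqr phi x
    + 1 / 2 * (r x + S) * (phi x ^+ 2 - 1 - S)
    - 1 / 4 * r x ^+ 2)
  + S ^+ 2 / 4 * volume Omega.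

Definition midpoint (phi psi : 'rV[R]_d -> R) : 'rV[R]_d -> R :=
  fun x => (phi x + psi x) / 2.

End energy.

(* Main.v *)
Require Import Defs.
From HB Require Import structures.
From mathcomp Require Import all_boot all_order all_algebra.
From mathcomp Require Import all_classical all_reals all_analysis.
From mathcomp Require Import real_interval measurable_realfun ring lra.

(** Testing the scheme with the increment [phi n.+1 - phi n] gives an exact
    balance: the modified energy increases from level [n] to [n + 1] by the
    integral of [mu n * (phi n.+1 - phi n)]
    ([modified_energy_increment]).  Two facts make it exact.  The Laplacian of
    the midpoint tested with the increment telescopes into the gradient part,
    by Green's formula ([green_of_bc]).  The relaxation equation says that
    [phi n ^+ 2 - 1 - S] is the mean of the two consecutive relaxation
    variables, so that the quadratic corrections in the modified energy cancel
    and leave the work of the linearized potential [(r n.+1 + S) * phi].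

    Since [mu] is [- M^-1] times the discrete Caputo derivative, summing the
    balance over the levels reduces the theorem to the pointwise statement that
    the sum of [(D u)^(m - 1/2) * (u m - u m.-1)], with [D] the discrete Caputo
    derivative, is nonnegative for every real sequence [u]
    ([L1plus_caputo_form_ge0]).  This sum is, up to the positive factor
    [1 / (2 Gamma(1 - alpha))], the quadratic form of the kernel
    [|x - s|^(- alpha)] evaluated at the step function whose values are the
    difference quotients of [u]; its positivity holds on any grid.

    To prove it, the kernel is integrated twice in closed form: the coefficients
    of the form are mixed second differences of [|x|^b] at the grid points, with
    [b = 2 - alpha], so that [1 < b < 2].  A scaling argument shows that [|x|^b]
    is a positive multiple of [\int_0^oo (1 - cos (x l)) l^(- 1 - b) dl]
    ([riesz_integral_homogeneous]), and the addition formula for the cosine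
    turns the form into an integral of sums of two squares
    ([power_mixed_diff_form_ge0]).

    Green's formula comes from a vanishing flux.  In the Neumann case this is
    the divergence theorem for [v grad u] ([integral_div_neumann]).  In the
    periodic case, the integral over the box of a partial derivative of a
    periodic function is zero by Fubini's theorem and the fundamental theorem
    of calculus along one coordinate ([integral_box_partial]). *)

Set Implicit Arguments.
Unset Strict Implicit.
Unset Printing Implicit Defensive.

Import Order.TTheory GRing.Theory Num.Theory.
Import numFieldNormedType.Exports.

Local Open Scope classical_set_scope.
Local Open Scope ring_scope.

(** * Powers as superpositions of cosines *)
Section riesz_kernel.
Context {R : realType}.
Local Notation leb := (@lebesgue_measure R).
Implicit Types (b c th y : R).

(** The dominating function for the densities below. *)
Lemma integrable_expR_norm c : 0 < c ->
  leb.-integrable setT (fun y => (expR (- c * `|y|))%:E).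
Proof.
move=> c0.
have cf : continuous (fun y : R => expR (- c * `|y|)).
  move=> y; apply: continuous_comp; last exact: continuous_expR.
  by apply: continuousM; [exact: cst_continuous | exact: norm_continuous].
apply/integrableP; split.
  by apply/measurable_EFinP; exact: continuous_measurable_fun.
under eq_integral do rewrite /= ger0_norm ?expR_ge0//.
rewrite ge0_symfun_integralT//; last by move=> y /=; rewrite normrN.
rewrite lte_mul_pinfty//.
apply: le_lt_trans (_ : ((c^-1)%:E < +oo)%E); last exact: ltry.
have -> : (c^-1)%:E = (\int[leb]_y ((c^-1)%:E * (exponential_pdf c y)%:E))%E.
  rewrite ge0_integralZl//.
  - by rewrite integral_exponential_pdf// mule1.
  - by apply/measurable_EFinP; exact: measurable_exponential_pdf.
  - by move=> y _; rewrite lee_fin exponential_pdf_ge0// ltW.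
  - by rewrite lee_fin invr_ge0 ltW.
rewrite integral_mkcond; apply: ge0_le_integral => //.
- by move=> y _; apply: erestrict_ge0 => {}y _; rewrite lee_fin expR_ge0.
- apply/(measurable_restrictT _ _).1.
    by rewrite -set_itvcy.
  apply: measurable_funTS; apply/measurable_EFinP.
  exact: continuous_measurable_fun.
- apply: measurable_funeM; apply/measurable_EFinP; exact: measurable_exponential_pdf.
move=> y _; rewrite patchE; case: ifPn => [|_].
  rewrite inE/= => y0; rewrite exponential_pdfE//.
  by rewrite -EFinM mulrA mulVf ?gt_eqF// mul1r ger0_norm.
by rewrite -EFinM lee_fin mulr_ge0 ?invr_ge0 ?exponential_pdf_ge0// ltW.
Qed.

Lemma norm_sin_le (x : R) : `|sin x| <= `|x|.
Proof.
wlog x0 : x / 0 <= x.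
  move=> H; have [/H//|x0] := leP 0 x.
  by rewrite -normrN -sinN -[leRHS]normrN; apply: H; rewrite oppr_ge0 ltW.
move: x0; rewrite le_eqVlt => /predU1P[<-|x0]; first by rewrite sin0 normr0.
have [|z _] := @MVT R sin cos 0 x x0 (fun z _ => is_derive_sin z).
  by apply: continuous_subspaceT => z; exact: continuous_sin.
by rewrite sin0 !subr0 => ->; rewrite normrM ler_piMl// cos_max.
Qed.

Lemma one_sub_cos_le_sqr (x : R) : 1 - cos x <= x ^+ 2.
Proof.
have -> : x = (x / 2) *+ 2 by rewrite mulr2n; field.
set y := x / 2; rewrite cos_mulr2n.
have := norm_sin_le y; rewrite -ler_sqr ?nnegrE// !real_normK ?num_real//.
rewrite sin2cos2 !mulr2n => h.
have := sqr_ge0 y; nra.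
Qed.

(** The density, in the variable [y = ln l], of the integral
    [\int_0^oo (1 - cos (th * l)) * l^(- 1 - b) dl].  In this variable a scaling
    of [th] is a translation of [y], and the density is continuous on the whole
    line, whereas in [l] it is unbounded near [0] if [1 < b]. *)
Definition riesz_density b th y : R := (1 - cos (th * expR y)) * expR (- b * y).

Lemma riesz_density_ge0 b th y : 0 <= riesz_density b th y.
Proof. by rewrite mulr_ge0 ?expR_ge0// subr_ge0 cos_le1. Qed.

Lemma continuous_riesz_density b th : continuous (riesz_density b th).
Proof.
move=> y.
apply: (@continuousM _ _ (fun y => 1 - cos (th * expR y)) (fun y => expR (- b * y))).
  apply: (@continuousB _ R^o _ (fun=> 1) (fun y => cos (th * expR y))).
    exact: cst_continuous.
  apply: continuous_comp; last exact: continuous_cos.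
  by apply: continuousM; [exact: cst_continuous|exact: continuous_expR].
apply: continuous_comp; last exact: continuous_expR.
by apply: continuousM => //; exact: cst_continuous.
Qed.

Lemma measurable_riesz_density b th :
  measurable_fun setT (EFin \o riesz_density b th).
Proof.
apply/measurable_EFinP; apply: continuous_measurable_fun.
exact: continuous_riesz_density.
Qed.

Lemma integrable_riesz_density b th : 0 < b < 2 ->
  leb.-integrable setT (fun y => (riesz_density b th y)%:E).
Proof.
move=> /andP[b0 b2].
pose c := Num.min b (2 - b).
have c0 : 0 < c by rewrite lt_min b0 subr_gt0.
have := integrableZl measurableT (2 + th ^+ 2) (integrable_expR_norm c0).
apply: le_integrable => //.
  exact: measurable_riesz_density.
move=> y _; rewrite /= lee_fin ger0_norm ?riesz_density_ge0//.
apply: le_trans (ler_norm _).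
(* At [+oo] the bound [1 - cos <= 2] suffices because [0 < b]; at [-oo] the
   bound [1 - cos z <= z ^+ 2] brings the factor [expR (2 * y)], hence
   [b < 2]. *)
have [y0|y0] := leP 0 y.
  rewrite ger0_norm// /riesz_density ler_pM ?expR_ge0 ?subr_ge0 ?cos_le1//.
    have := cos_geN1 (th * expR y); have := sqr_ge0 th; lra.
  by rewrite ler_expR !mulNr lerN2 ler_wpM2r// ge_min lexx.
rewrite ltr0_norm// /riesz_density.
apply: (@le_trans _ _ ((th * expR y) ^+ 2 * expR (- b * y))).
  by rewrite ler_wpM2r ?expR_ge0// one_sub_cos_le_sqr.
rewrite exprMn -mulrA -expRM_natl -expRD ler_pM ?sqr_ge0 ?expR_ge0 ?lerDr//.
rewrite ler_expR mulrNN -mulrDl -subr_ge0 -mulrBl nmulr_lge0//.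
by rewrite subr_le0 ge_min lexx orbT.
Qed.

Definition riesz_integral b th : R := \int[leb]_y riesz_density b th y.

Lemma riesz_integral0 b : riesz_integral b 0 = 0.
Proof.
rewrite /riesz_integral /Rintegral integral0_eq// => y _.
by rewrite /riesz_density mul0r cos0 subrr mul0r.
Qed.

(** If [`|th| = expR a], the density at [th] is [expR (b * a)] times the
    translate by [a] of the density at [1]. *)
Lemma riesz_integral_homogeneous b th :
  0 < b < 2 -> riesz_integral b th = `|th| `^ b * riesz_integral b 1.
Proof.
move=> b02; have [->|th0] := eqVneq th 0.
  rewrite riesz_integral0 normr0 powR0 ?mul0r// gt_eqF//.
  by case/andP : b02.
have {th0} [a ea] : exists a, expR a = `|th|.
  by apply: expR_total; rewrite normr_gt0.
rewrite -ea -expRM.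
pose G := riesz_density b 1.
have dF : (fun y : R => y + a)^`()%classic = cst 1.
  by apply/funext => y; rewrite derive1E deriveD// derive_id derive_cst addr0.
have -> : riesz_integral b 1 = \int[leb]_y G (y + a).
  rewrite /riesz_integral /Rintegral.
  rewrite (@increasing_ge0_integration_by_substitutionT R (fun y => y + a) G)//.
  - by congr fine; apply: eq_integral => y _; rewrite dF /= fctE mulr1.
  - by move=> x y; rewrite ltrD2r.
  - by rewrite dF; exact: cst_continuous.
  - by rewrite dF; exact: is_cvg_cst.
  - by rewrite dF; exact: is_cvg_cst.
  - exact: cvg_addrr_Ny.
  - exact: cvg_addrr.
  - exact: continuous_riesz_density.
  - by move=> x; exact: riesz_density_ge0.
have GE y : G (y + a) = expR (- b * a) * riesz_density b th y.
  rewrite /G /riesz_density mul1r (expRD y a) ea -(cos_norm (th * _)) normrM.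
  rewrite (gtr0_norm (expR_gt0 y)) (mulrC `|th|) mulrCA -expRD.
  by congr (_ * expR _); ring.
rewrite -RintegralZl//; last first.
  have := integrableZl measurableT (expR (- b * a)) (integrable_riesz_density th b02).
  by apply: eq_integrable => // y _; rewrite -EFinM -GE.
apply: eq_Rintegral => y _.
by rewrite GE mulrA -expRD mulNr (mulrC a) subrr expR0 mul1r.
Qed.

Lemma riesz_integral_gt0 b : 0 < b < 2 -> 0 < riesz_integral b 1.
Proof.
move=> b02; have ib := integrable_riesz_density 1 b02.
rewrite lt_neqAle Rintegral_ge0 ?andbT; last by move=> y _; exact: riesz_density_ge0.
apply/eqP => J0.
(* A lower bound of the density on [-1, 0]. *)
pose m := 1 - cos (expR (- 1)) : R.
have e1 : expR (-1) <= 1 :> R by rewrite expR_le1 lerN10.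
have pi1 : 1 <= pi :> R by rewrite (le_trans _ (pi_ge2 _))// ler1n.
have m0 : 0 < m.
  rewrite subr_gt0 -[ltRHS]cos0 ltr_cos ?expR_gt0 ?in_itv//= ?lexx ?pi_ge0//.
  by rewrite expR_ge0 (le_trans e1).
have : (m%:E <= \int[leb]_y (riesz_density b 1 y)%:E)%E.
  apply: (@le_trans _ _ (\int[leb]_(y in `[(-1)%R, 0%R]) m%:E)%E).
    rewrite integral_cst//= lebesgue_measure_itv/= lte_fin ltrN10.
    by rewrite -EFinD sub0r opprK mule1.
  apply: (@le_trans _ _ (\int[leb]_(y in `[(-1)%R, 0%R]) (riesz_density b 1 y)%:E)%E).
    apply: ge0_le_integral => //.
    - by move=> y _; rewrite lee_fin ltW.
    - by apply: measurable_funTS; exact: measurable_riesz_density.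
    move=> y /=; rewrite in_itv/= => /andP[y1 y0].
    have ey1 : expR y <= 1 by rewrite expR_le1.
    rewrite lee_fin /riesz_density mul1r -[leLHS]mulr1 ler_pM ?(ltW m0)//.
      rewrite lerD2l lerN2 leNgt ltr_cos ?in_itv/= ?expR_ge0/= -?leNgt ?ler_expR//.
        by rewrite (le_trans ey1).
      by rewrite (le_trans e1).
    rewrite -expR0 ler_expR mulNr -mulrN mulr_ge0 ?oppr_ge0//.
    by case/andP : b02 => /ltW.
  apply: ge0_subset_integral => //.
  - exact: measurable_riesz_density.
  - by move=> y _; rewrite lee_fin riesz_density_ge0.
rewrite -[X in (_ <= X)%E]fineK; last exact: integrable_fin_num.
by rewrite lee_fin -/(Rintegral _ _ _) -/(riesz_integral b 1) -J0 leNgt m0.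
Qed.
End riesz_kernel.

(** * Mixed differences of a power *)
Section Rintegral_sum.
Context d (T : measurableType d) (R : realType).
Variables (m : {measure set T -> \bar R}) (D : set T).
Hypothesis mD : measurable D.

Lemma integrable_EFin_sum (I : Type) (s : seq I) (P : pred I) (f : I -> T -> R) :
  (forall i, m.-integrable D (EFin \o f i)) ->
  m.-integrable D (fun x => (\sum_(i <- s | P i) f i x)%:E).
Proof.
move=> fi; under eq_fun do rewrite -sumEFin.
by apply: integrable_sum => // i _; exact: fi.
Qed.

Lemma Rintegral_sum (I : Type) (s : seq I) (P : pred I) (f : I -> T -> R) :
  (forall i, m.-integrable D (EFin \o f i)) ->
  \int[m]_(x in D) (\sum_(i <- s | P i) f i x) =
  \sum_(i <- s | P i) \int[m]_(x in D) f i x.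
Proof.
move=> fi; elim: s => [|i s ih].
  rewrite big_nil /Rintegral integral0_eq// => x _.
  by rewrite big_nil.
rewrite big_cons -ih; case: ifPn => Pi; last first.
  by apply: eq_Rintegral => x _; rewrite big_cons (negbTE Pi).
rewrite -RintegralD//; last exact: integrable_EFin_sum.
by apply: eq_Rintegral => x _; rewrite big_cons Pi.
Qed.

End Rintegral_sum.

Section mixed_difference.
Context {R : realType}.
Local Notation leb := (@lebesgue_measure R).
Implicit Types (b : R) (t w : nat -> R).

(** For [1 < b], this is [b * (b - 1)] times the integral of [|x - s|^(b - 2)]
    for [x] in the [m]-th and [s] in the [k]-th interval of the grid [t]. *)
Definition power_mixed_diff b t (m k : nat) : R :=
  `|t m.+1 - t k| `^ b + `|t m - t k.+1| `^ b
  - `|t m.+1 - t k.+1| `^ b - `|t m - t k| `^ b.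

Lemma power_mixed_diffC b t m k :
  power_mixed_diff b t m k = power_mixed_diff b t k m.
Proof.
rewrite /power_mixed_diff (distrC (t m.+1) (t k)) (distrC (t m)).
by rewrite (distrC (t m.+1)) (distrC (t m) (t k)) (addrC (_ `^ _)).
Qed.

Let density_mixed_diff b t m k y : R :=
  riesz_density b (t m.+1 - t k) y + riesz_density b (t m - t k.+1) y
  - riesz_density b (t m.+1 - t k.+1) y - riesz_density b (t m - t k) y.

Let integrable_mixed b t m k : 0 < b < 2 ->
  leb.-integrable setT (EFin \o density_mixed_diff b t m k).
Proof.
move=> b02.
have i th := @integrable_riesz_density R b th b02.
exact: (integrableB measurableT (integrableB measurableT
  (integrableD measurableT (i (t m.+1 - t k)) (i (t m - t k.+1)))
  (i (t m.+1 - t k.+1))) (i (t m - t k))).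
Qed.

Let Rintegral_mixed b t m k : 0 < b < 2 ->
  \int[leb]_y density_mixed_diff b t m k y =
  riesz_integral b 1 * power_mixed_diff b t m k.
Proof.
move=> b02.
have i th := @integrable_riesz_density R b th b02.
have i2 := integrableD measurableT (i (t m.+1 - t k)) (i (t m - t k.+1)).
have i3 := integrableB measurableT i2 (i (t m.+1 - t k.+1)).
rewrite RintegralB//; last exact: i.
rewrite RintegralB//; last exact: i.
rewrite RintegralD//; [|exact: i..].
have J th : \int[leb]_y riesz_density b th y = `|th| `^ b * riesz_integral b 1.
  exact: riesz_integral_homogeneous.
rewrite !J.
by rewrite /power_mixed_diff; ring.
Qed.

(** In a mixed difference of [1 - cos (t m - t k)] the constants cancel and
    [cos (x - y) = cos x cos y + sin x sin y] separates the variables, so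
    integrating against the weights gives two squares for each frequency. *)
Lemma power_mixed_diff_form_ge0 b t w n : 0 < b < 2 ->
  0 <= \sum_(m < n) \sum_(k < n) w m * w k * power_mixed_diff b t m k.
Proof.
move=> b02; rewrite -(pmulr_rge0 _ (riesz_integral_gt0 b02)).
pose q y := \sum_(m < n) \sum_(k < n) w m * w k * density_mixed_diff b t m k y.
have iq m k : leb.-integrable setT
    (fun y => (w m * w k * density_mixed_diff b t m k y)%:E).
  exact: (integrableZl measurableT (w m * w k) (integrable_mixed t m k b02)).
suff -> : riesz_integral b 1 *
    (\sum_(m < n) \sum_(k < n) w m * w k * power_mixed_diff b t m k) =
    \int[leb]_y q y.
  apply: Rintegral_ge0 => y _.
  pose c j := cos (t j * expR y); pose s j := sin (t j * expR y).
  have -> : q y = ((\sum_(m < n) w m * (c m.+1 - c m)) ^+ 2 +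
                   (\sum_(m < n) w m * (s m.+1 - s m)) ^+ 2) * expR (- b * y).
    rewrite !expr2 !mulr_suml -big_split mulr_suml; apply: eq_bigr => m _.
    rewrite -!mulrA !mulr_sumr -big_split /= mulr_suml.
    apply: eq_bigr => k _; rewrite /density_mixed_diff /riesz_density.
    rewrite !(mulrBl, cosB) /c /s; ring.
  by rewrite mulr_ge0 ?expR_ge0// addr_ge0// sqr_ge0.
rewrite Rintegral_sum//; last first.
  by move=> m; apply: integrable_EFin_sum => // k; exact: iq.
rewrite mulr_sumr; apply: eq_bigr => m _.
rewrite Rintegral_sum//; last by move=> k; exact: iq.
rewrite mulr_sumr; apply: eq_bigr => k _.
rewrite RintegralZl//; last exact: integrable_mixed.
by rewrite Rintegral_mixed// mulrCA.
Qed.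

End mixed_difference.

(** * Integrals of powers *)
Section powR_calculus.
Context {R : realType}.
Local Notation leb := (@lebesgue_measure R).
Implicit Types (p a b c x : R).

Let is_derive_powR_comp p (f : R -> R) df s : 0 < f s ->
  is_derive s 1 f df ->
  is_derive s 1 (fun s => f s `^ p) (p * f s `^ (p - 1) * df).
Proof.
by move=> fs0 h; exact: (is_derive1_comp (is_derive1_powR p fs0) h).
Qed.

Lemma is_derive_powR_subl p x s : p != 0 -> s < x ->
  is_derive s 1 (fun s => - (x - s) `^ p / p) ((x - s) `^ (p - 1)).
Proof.
move=> p0 sx.
have g : is_derive s 1 (fun s : R => x - s) (-1).
  by apply: is_derive_eq; rewrite add0r mul1r.
have h := @is_derive_powR_comp p _ _ s _ g.
have {}h := h ltac:(by rewrite subr_gt0).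
have := is_deriveZ (- p^-1) h.
rewrite (_ : _ \*: _ = (fun s => - (x - s) `^ p / p)); last first.
  by apply/funext => y /=; rewrite scaleNr mulNr mulrC.
move=> k; apply: is_derive_eq.
by rewrite mulrN1 scaleNr scalerN opprK /GRing.scale/= mulKf.
Qed.

Lemma is_derive_powR_subr p a s : p != 0 -> a < s ->
  is_derive s 1 (fun s => (s - a) `^ p / p) ((s - a) `^ (p - 1)).
Proof.
move=> p0 sx.
have g : is_derive s 1 (fun s : R => s - a) 1.
  by apply: is_derive_eq; rewrite oppr0 addr0.
have h := @is_derive_powR_comp p _ _ s _ g.
have {}h := h ltac:(by rewrite subr_gt0).
have := is_deriveZ (p^-1) h.
rewrite (_ : _ \*: _ = (fun s => (s - a) `^ p / p)); last first.
  by apply/funext => y /=; rewrite /GRing.scale/= mulrC.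
by move=> k; apply: is_derive_eq; rewrite mulr1 /GRing.scale/= mulKf.
Qed.

Lemma cvg_powR_sub_right p a : 0 < p -> (s - a) `^ p @[s --> a^'+] --> 0.
Proof.
move=> p0; apply/cvg_at_rightP => u [ua cu].
have /cvg_at_rightP := powR_cvg0 p0; apply; split => [n|].
  by rewrite subr_gt0.
by rewrite -[X in _ --> X](subrr a); apply: cvgB => //; exact: cvg_cst.
Qed.

Lemma continuous_powR_sub p a s : 0 < p -> a < s ->
  {for s, continuous (fun s => (s - a) `^ p)}.
Proof.
move=> p0 as_; apply/differentiable_continuous/derivable1_diffP.
have p0' : p != 0 by rewrite gt_eqF.
have -> : (fun s => (s - a) `^ p) = p \*: (fun s => (s - a) `^ p / p).
  by apply/funext => y /=; rewrite /GRing.scale/= mulrC divfK.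
by have [] := is_deriveZ p (is_derive_powR_subr p0' as_).
Qed.

Lemma within_continuous_powR_sub p a b c : 0 < p -> a <= b -> b < c ->
  {within `[b, c], continuous (fun s => (s - a) `^ p)}.
Proof.
move=> p0 ab bc; apply/continuous_within_itvP => //; split.
- move=> s; rewrite in_itv/= => /andP[bs _].
  by apply: continuous_powR_sub => //; exact: le_lt_trans bs.
- move: ab; rewrite le_eqVlt => /predU1P[<-|ab].
    by rewrite subrr powR0 ?gt_eqF//; exact: cvg_powR_sub_right.
  by apply: cvg_at_right_filter; exact: continuous_powR_sub.
- apply: cvg_at_left_filter; apply: continuous_powR_sub => //.
  exact: le_lt_trans bc.
Qed.

Lemma integral_powR_sub p a b c : 0 < p -> a <= b -> b <= c ->
  \int[leb]_(s in `[b, c]) ((s - a) `^ p) =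
  ((c - a) `^ (p + 1) - (b - a) `^ (p + 1)) / (p + 1).
Proof.
move=> p0 ab; have p1 : p + 1 != 0 by rewrite gt_eqF// addr_gt0.
have p1' : 0 < p + 1 by rewrite addr_gt0.
rewrite le_eqVlt => /predU1P[<-|bc].
  by rewrite set_itv1 Rintegral_set1 subrr mul0r.
pose F s := (s - a) `^ (p + 1) / (p + 1).
have dF s : b < s -> is_derive s 1 F ((s - a) `^ p).
  move=> bs; have as_ := le_lt_trans ab bs.
  have := is_derive_powR_subr p1 as_.
  by rewrite addrK.
rewrite /Rintegral (@continuous_FTC2 _ _ F)//.
- by rewrite -EFinB /= mulrBl.
- exact: within_continuous_powR_sub.
- have /continuous_within_itvP[//|_ Fb Fc] := within_continuous_powR_sub p1' ab bc.
  split => [s||]; first by rewrite in_itv/= => /andP[/dF[]].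
  + exact: cvgMr_tmp Fb.
  + exact: cvgMr_tmp Fc.
- move=> s; rewrite in_itv/= => /andP[/dF dFs _].
  by rewrite derive1E derive_val.
Qed.

Let integral_powR_subl_lt p a b x : 0 < p -> a <= b -> b < x ->
  (\int[leb]_(s in `[a, b]) ((x - s) `^ (p - 1))%:E)%E =
  (((x - a) `^ p - (x - b) `^ p) / p)%:E.
Proof.
move=> p0 + bx; rewrite le_eqVlt => /predU1P[->|ab].
  by rewrite set_itv1 integral_set1 subrr mul0r.
have p0' : p != 0 by rewrite gt_eqF.
pose F s := - (x - s) `^ p / p.
have cF : {within `[a, b], continuous F}.
  apply: derivable_within_continuous => s; rewrite in_itv/= => /andP[_ sb].
  by case: (is_derive_powR_subl p0' (le_lt_trans sb bx)).
rewrite (@continuous_FTC2 _ _ F)//.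
- by rewrite -EFinB /F; congr EFin; rewrite -mulrBl opprK addrC.
- apply: derivable_within_continuous => s; rewrite in_itv/= => /andP[_ sb].
  have [p1|p1] := eqVneq (p - 1) 0.
    rewrite p1; under eq_fun do rewrite powRr0.
    exact: derivable_cst.
  have -> : (fun s => (x - s) `^ (p - 1)) =
      (1 - p) \*: (fun s => - (x - s) `^ (p - 1) / (p - 1)).
    apply/funext => y /=; rewrite /GRing.scale/= mulNr mulrN -mulNr opprB.
    by rewrite mulrC divfK.
  by have [] := is_deriveZ (1 - p) (is_derive_powR_subl p1 (le_lt_trans sb bx)).
- have /continuous_within_itvP[//|_ Fb Fc] := cF; split => // s.
  rewrite in_itv/= => /andP[_ sb].
  by case: (is_derive_powR_subl p0' (lt_trans sb bx)).
- move=> s; rewrite in_itv/= => /andP[_ sb].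
  have h := is_derive_powR_subl p0' (lt_trans sb bx).
  by rewrite derive1E derive_val.
Qed.

Let measurable_powR_subl p x (D : set R) :
  measurable_fun D (fun s => ((x - s) `^ p)%:E).
Proof.
apply: measurable_funTS; apply/measurable_EFinP.
apply: (@measurableT_comp _ _ _ _ _ _ (fun y : R => y `^ p)).
  exact: measurable_powR.
by apply: measurable_funB.
Qed.

(** For [b = x] and [p < 1] the integrand is unbounded at [x]: the formula
    passes to the limit on the intervals [a, x - 1 / (n + 1)] by monotone
    convergence. *)
Lemma Rintegral_powR_subl p a b x : 0 < p -> a <= b -> b <= x ->
  \int[leb]_(s in `[a, b]) ((x - s) `^ (p - 1)) =
  ((x - a) `^ p - (x - b) `^ p) / p.
Proof.
move=> p0 ab; rewrite le_eqVlt => /predU1P[bx|bx]; last first.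
  by rewrite /Rintegral integral_powR_subl_lt.
subst x; move: ab; rewrite le_eqVlt => /predU1P[->|ab].
  by rewrite set_itv1 Rintegral_set1 subrr mul0r.
rewrite /Rintegral -integral_itv_bndo_bndc; last exact: measurable_powR_subl.
rewrite itv_bnd_open_bigcup.
rewrite subrr powR0 ?gt_eqF// subr0.
set F := fun k : nat => _.
have cv : (\int[leb]_(s in F i) ((b - s) `^ (p - 1))%:E)%E @[i --> \oo] -->
    (\int[leb]_(s in \bigcup_i F i) ((b - s) `^ (p - 1))%:E)%E.
  apply: ge0_nondecreasing_set_cvg_integral.
  - apply/nondecreasing_seqP => n; apply/subsetPset => s; rewrite /F/= !in_itv/=.
    move=> /andP[-> /le_trans]; apply; rewrite lerD2l lerN2.
    by rewrite lef_pV2 ?posrE// ler_nat.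
  - by move=> n; exact: measurable_itv.
  - by move=> n; exact: measurable_powR_subl.
  - by move=> n s _; rewrite lee_fin powR_ge0.
have cv2 : (\int[leb]_(s in F i) ((b - s) `^ (p - 1))%:E)%E @[i --> \oo] -->
    ((b - a) `^ p / p)%:E.
  have : (((b - a) `^ p - i.+1%:R^-1 `^ p) / p)%:E @[i --> \oo] -->
    (((b - a) `^ p - 0) / p)%:E.
    apply: cvg_EFin; first exact: nearW.
    apply: cvgMr_tmp; apply: cvgB; first exact: cvg_cst.
    have /cvg_at_rightP := powR_cvg0 p0; apply; split => [n|].
      by rewrite invr_gt0.
    exact: cvg_harmonic.
  rewrite subr0; apply: cvg_trans; apply: near_eq_cvg.
  near=> i.
  rewrite /F integral_powR_subl_lt//.
  - by rewrite subKr.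
  - have : i.+1%:R^-1 <= b - a.
      near: i; have /cvgr_le := @cvg_harmonic R; apply.
      by rewrite subr_gt0.
    by move=> h; rewrite -[leLHS](subKr b) lerD2l lerN2.
  - by rewrite gtrDl oppr_lt0 invr_gt0.
by rewrite (cvg_unique _ cv cv2).
Unshelve. all: by end_near. Qed.

End powR_calculus.

(** * Positivity of the discrete Caputo derivative *)
Lemma sum_ord_sym (V : nmodType) (a : nat -> nat -> V) n :
  (forall m k, a m k = a k m) ->
  \sum_(m < n) \sum_(k < n) a m k =
  \sum_(m < n) (a m m + (\sum_(k < m) a m k) *+ 2).
Proof.
move=> aC; elim: n => [|n ih]; first by rewrite !big_ord0.
rewrite big_ord_recr/= [RHS]big_ord_recr/= -ih.
under eq_bigr do rewrite big_ord_recr/=.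
rewrite big_split/= -addrA; congr (_ + _).
rewrite big_ord_recr/= addrA [RHS]addrC mulr2n; congr (_ + _ + _).
by apply: eq_bigr => i _.
Qed.

Section L1plus_positivity.
Context {R : realType}.
Local Notation leb := (@lebesgue_measure R).
Variables (alpha : R) (t : nat -> R) (N : nat).
Hypothesis halpha : 0 < alpha < 1.
Hypothesis tS : forall k, (k < N)%N -> t k < t k.+1.

Let p := 1 - alpha.
Let p0 : 0 < p. Proof. by rewrite subr_gt0; case/andP: halpha. Qed.
Let pE : - alpha = p - 1. Proof. by rewrite /p; ring. Qed.

Lemma time_grid_le j k : (j <= k)%N -> (k <= N)%N -> t j <= t k.
Proof.
elim: k => [|k ih]; first by rewrite leqn0 => /eqP->.
rewrite leq_eqVlt => /predU1P[->//|]; rewrite ltnS => jk kN.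
by rewrite (le_trans (ih jk (ltnW kN)))// ltW// tS.
Qed.

Lemma L1plus_coef_offdiag m j : (j < m)%N -> (m < N)%N ->
  L1plus_coef alpha t m.+1 j.+1 =
  (Gamma (1 - alpha) * tau t m.+1 * tau t j.+1)^-1 *
  (power_mixed_diff (p + 1) t m j / (p * (p + 1))).
Proof.
move=> jm mN; rewrite /L1plus_coef /=; congr (_ * _).
have tm := tS mN.
have tjm : t j.+1 <= t m by apply: time_grid_le => //; exact: ltnW.
have tj : t j < t j.+1 by apply: tS; exact: ltn_trans mN.
transitivity (\int[leb]_(x in `[t m, t m.+1])
    (p^-1 * ((x - t j) `^ p - (x - t j.+1) `^ p))).
  apply: eq_Rintegral => x; rewrite inE/= in_itv/= => /andP[mx xm].
  have jx := le_trans tjm mx.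
  by rewrite (min_idPl jx) pE Rintegral_powR_subl// ?(ltW tj)// mulrC.
have ii a : a <= t m ->
    leb.-integrable `[t m, t m.+1] (EFin \o (fun x => (x - a) `^ p)).
  move=> am; apply: continuous_compact_integrable; first exact: segment_compact.
  exact: within_continuous_powR_sub.
have i1 := ii _ (ltW (lt_le_trans tj tjm)); have i2 := ii _ tjm.
rewrite RintegralZl//; last by apply: (integrableB _ i1 i2).
rewrite RintegralB// !integral_powR_sub// ?(ltW tm)// ?(ltW (lt_le_trans tj tjm))//.
rewrite /power_mixed_diff !ger0_norm ?subr_ge0 ?(le_trans tjm)//;
  try by rewrite ?(ltW tm) ?(le_trans (ltW tj))// (le_trans tjm)// ltW.
have pn : p != 0 by rewrite gt_eqF.
have pn1 : p + 1 != 0 by rewrite gt_eqF// addr_gt0.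
by field; rewrite pn pn1.
Qed.

(** On the diagonal only the half [s <= x] of the square is integrated, hence
    the factor [1 / 2]. *)
Lemma L1plus_coef_diag m : (m < N)%N ->
  L1plus_coef alpha t m.+1 m.+1 =
  (Gamma (1 - alpha) * tau t m.+1 * tau t m.+1)^-1 *
  (power_mixed_diff (p + 1) t m m / 2 / (p * (p + 1))).
Proof.
move=> mN; rewrite /L1plus_coef /=; congr (_ * _).
have tm := tS mN.
transitivity (\int[leb]_(x in `[t m, t m.+1]) (p^-1 * (x - t m) `^ p)).
  apply: eq_Rintegral => x; rewrite inE/= in_itv/= => /andP[mx xm].
  rewrite (min_idPr xm) pE Rintegral_powR_subl// subrr powR0 ?gt_eqF//.
  by rewrite subr0 mulrC.
rewrite RintegralZl//; last first.
  apply: continuous_compact_integrable; first exact: segment_compact.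
  exact: within_continuous_powR_sub.
rewrite integral_powR_sub// ?(ltW tm)// /power_mixed_diff !subrr normr0.
rewrite (distrC (t m)) (gtr0_norm (_ : 0 < t m.+1 - t m)) ?subr_gt0//.
have pn : p != 0 by rewrite gt_eqF.
have pn1 : p + 1 != 0 by rewrite gt_eqF// addr_gt0.
rewrite powR0//.
by field; rewrite pn pn1.
Qed.

(** The halved diagonal and the symmetry of the mixed differences make this
    triangular sum one half of a full quadratic form, the weights being the
    difference quotients of [u]. *)
Lemma L1plus_caputo_form_ge0 (u : nat -> R) n : (n <= N)%N ->
  0 <= \sum_(m < n) L1plus_caputo alpha t u m.+1 * (u m.+1 - u m).
Proof.
move=> nN.
pose w k := (u k.+1 - u k) / tau t k.+1.
pose a m k := w m * w k * power_mixed_diff (p + 1) t m k.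
pose C := (Gamma (1 - alpha) * (p * (p + 1)) * 2)^-1.
have C0 : 0 <= C.
  have pp : 0 <= p * (p + 1) by rewrite mulr_ge0 ?ltW// addr_gt0.
  rewrite invr_ge0 mulr_ge0// mulr_ge0//; apply: Rintegral_ge0 => x _.
  by rewrite mulr_ge0 ?powR_ge0 ?expR_ge0.
suff -> : \sum_(m < n) L1plus_caputo alpha t u m.+1 * (u m.+1 - u m) =
    C * \sum_(m < n) \sum_(k < n) a m k.
  rewrite mulr_ge0// power_mixed_diff_form_ge0// addr_gt0//=.
  by rewrite /p; case/andP: halpha => h1 h2; lra.
rewrite sum_ord_sym; last first.
  by move=> m k; rewrite /a power_mixed_diffC (mulrC (w m)).
rewrite mulr_sumr; apply: eq_bigr => m _.
have mN : (m < N)%N by apply: leq_trans nN.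
have tau0 k : (k < N)%N -> tau t k.+1 != 0.
  by move=> kN; rewrite gt_eqF// subr_gt0 tS.
rewrite /L1plus_caputo big_add1 /= big_nat_recr//= big_mkord.
rewrite [LHS]mulrDl [RHS]mulrDr [LHS]addrC.
congr (_ + _).
  rewrite L1plus_coef_diag// /a /w /C !invfM; ring.
rewrite mulr_suml -sumrMnl mulr_sumr; apply: eq_bigr => k _.
have km : (k < m)%N := ltn_ord k.
rewrite L1plus_coef_offdiag// /a /w /C !invfM mulr2n.
have half2 : 2^-1 + 2^-1 = 1 :> R by field.
by rewrite -[LHS]mulr1 -[X in _ * X = _]half2; ring.
Qed.

End L1plus_positivity.

(** * Measurability and integrability on a bounded open set *)
Section borel_tuple.
Context {R : realType} {d : nat}.
Local Notation T := (d.-tuple (measurableTypeR R)).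

Lemma row_coord_le_norm (x : 'rV[R]_d) i : `|x 0 i| <= `|x|.
Proof.
have /mapP[j Hj ->] : `|x 0 i| \in [seq `|x y.1 y.2| | y : 'I_1 * 'I_d].
  by apply/mapP; exists (ord0, i) => //=; rewrite mem_enum.
by rewrite [leRHS]/Num.norm /= mx_normrE; apply/bigmax_geP; right => /=; exists j.
Qed.

Lemma measurable_coord_box (A : 'I_d -> set (measurableTypeR R)) :
  (forall i, measurable (A i)) ->
  measurable [set u : T | forall i, A i (tnth u i)].
Proof.
move=> mA; rewrite (_ : [set u | _] = \bigcap_(i : 'I_d)
  ((fun u : T => tnth u i) @^-1` A i)).
  apply: fin_bigcap_measurable => // i _.
  by rewrite -[X in measurable X]setTI; exact: measurable_tnth.
by apply/seteqP; split=> [u H i _|u H i]; [exact: H|exact: (H i I)].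
Qed.

(** Boxes with rational center and radius [1 / (n + 1)] form a countable base of
    the topology of row vectors, and [vec] pulls each of them back to a product
    of measurable sets. *)
Lemma measurable_preimage_vec_open (U : set 'rV[R]_d) :
  open U -> measurable (vec @^-1` U : set T).
Proof.
move=> oU.
pose box (q : {ffun 'I_d -> rat} * nat) : set 'rV[R]_d :=
  [set x | forall i, `|x 0 i - ratr (q.1 i)| < q.2.+1%:R^-1].
have -> : vec @^-1` U = \bigcup_q
    (if `[< box q `<=` U >] then vec @^-1` box q else set0) :> set T.
  apply/seteqP; split => [u Uu|u [q _]]; last first.
    by case: asboolP => // bU; exact: bU.
  have [e /= e0 eU] : nbhs_ball (vec u) U by apply/nbhs_ballP; exact: oU.
  have [n ne] : exists n : nat, n.+1%:R^-1 < e / 2.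
    exists (Num.truncn (e / 2)^-1).
    rewrite invf_plt ?posrE ?divr_gt0//; exact: truncnS_gt.
  have [q qP] : exists q : {ffun 'I_d -> rat},
      forall i, `|vec u 0 i - ratr (q i)| < n.+1%:R^-1.
    have H i : exists q, `|vec u 0 i - ratr q| < n.+1%:R^-1.
      have : 0 < n.+1%:R^-1 :> R by rewrite invr_gt0.
      move: (n.+1%:R^-1) => r r0.
      have /rat_in_itvoo[q] : vec u 0 i - r < vec u 0 i + r by lra.
      rewrite in_itv/= => /andP[h1 h2]; exists q.
      by rewrite ltr_norml; apply/andP; split; lra.
    exists [ffun i => projT1 (cid (H i))] => i.
    by rewrite ffunE; case: cid.
  exists (q, n) => //; case: asboolP => // -[] y /= yq; apply: eU.
  split => // i j; rewrite (ord1 i) -ball_normE /ball_/=.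
  have -> : vec u 0 j - y 0 j =
      (vec u 0 j - ratr (q j)) - (y 0 j - ratr (q j)) by ring.
  rewrite (le_lt_trans (ler_normB _ _))// (splitr e) ltrD//.
    by rewrite (lt_trans (qP j)).
  by rewrite (lt_trans (yq j)).
apply: countable_bigcupT_measurable => // q.
case: asboolP => // _.
pose A i : set R := [set r | `|r - ratr (q.1 i)| < q.2.+1%:R^-1].
rewrite (_ : _ @^-1` _ = [set u | forall i, A i (tnth u i)]).
  apply: measurable_coord_box => i; rewrite /A.
  rewrite (_ : [set r | _] = ball (ratr (q.1 i) : R) q.2.+1%:R^-1).
    by apply: open_measurable; exact: ball_open.
  by apply/seteqP; split => r; rewrite -ball_normE /ball_/= distrC.
by apply/seteqP; split => u /= H i; move: (H i); rewrite mxE.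
Qed.

Lemma measurable_fun_vec (D : set 'rV[R]_d) (h : 'rV[R]_d -> R) :
  measurable (vec @^-1` D : set T) -> {within D, continuous h} ->
  measurable_fun (vec @^-1` D : set T) (h \o vec).
Proof.
move=> mD /continuousP ch.
apply: (measurability _ (RGenOpens.measurableE R)).
move=> _ [_ [a [b ->] <-]].
have /open_subspaceP[W oW WD] : open ((h : subspace D -> R) @^-1` `]a, b[).
  by apply: ch; exact: interval_open.
rewrite (_ : _ `&` _ = vec @^-1` W `&` vec @^-1` D); last first.
  apply/seteqP; split => u /= [].
    move=> Du hu; suff [] : (W `&` D) (vec u) by [].
    by rewrite WD.
  move=> Wu Du; suff [] : ((h : subspace D -> R) @^-1` `]a, b[ `&` D) (vec u) by [].
  by rewrite -WD.
by apply: measurableI => //; exact: measurable_preimage_vec_open.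
Qed.

End borel_tuple.

Section continuous_extension.
Context {R : realType} {d : nat}.
Implicit Types (Omega : set 'rV[R]_d) (f g : 'rV[R]_d -> R).

Lemma eq_extends_continuously Omega f g :
  (forall x, Omega x -> f x = g x) ->
  extends_continuously Omega f -> extends_continuously Omega g.
Proof.
by move=> fg [h ch hf]; exists h => // x Ox; rewrite hf// fg.
Qed.

Lemma extends_continuously_cst Omega (k : R) :
  extends_continuously Omega (fun=> k).
Proof. by exists (fun=> k) => // x; exact: cvg_cst. Qed.

Lemma extends_continuouslyD Omega f g :
  extends_continuously Omega f -> extends_continuously Omega g ->
  extends_continuously Omega (fun x => f x + g x).
Proof.
move=> [h ch hf] [k ck kg]; exists (fun x => h x + k x).
  by move=> x; apply: cvgD; [exact: ch|exact: ck].
by move=> x Ox; rewrite hf// kg.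
Qed.

Lemma extends_continuouslyM Omega f g :
  extends_continuously Omega f -> extends_continuously Omega g ->
  extends_continuously Omega (fun x => f x * g x).
Proof.
move=> [h ch hf] [k ck kg]; exists (fun x => h x * k x).
  by move=> x; apply: cvgM; [exact: ch|exact: ck].
by move=> x Ox; rewrite hf// kg.
Qed.

Lemma extends_continuouslyZ Omega (c : R) f :
  extends_continuously Omega f -> extends_continuously Omega (fun x => c * f x).
Proof. by apply: extends_continuouslyM; exact: extends_continuously_cst. Qed.

Lemma extends_continuouslyN Omega f :
  extends_continuously Omega f -> extends_continuously Omega (fun x => - f x).
Proof.
move=> /(extends_continuouslyZ (-1)).
by apply: eq_extends_continuously => x _; rewrite mulN1r.
Qed.

Lemma extends_continuouslyX Omega f n :
  extends_continuously Omega f -> extends_continuously Omega (fun x => f x ^+ n).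
Proof.
move=> ef; elim: n => [|n ih].
  by under eq_fun do rewrite expr0; exact: extends_continuously_cst.
by under eq_fun do rewrite exprS; exact: extends_continuouslyM.
Qed.

Lemma extends_continuously_sum Omega I (s : seq I) (P : pred I)
    (f : I -> 'rV[R]_d -> R) :
  (forall i, extends_continuously Omega (f i)) ->
  extends_continuously Omega (fun x => \sum_(i <- s | P i) f i x).
Proof.
move=> ef; elim: s => [|i s ih].
  by under eq_fun do rewrite big_nil; exact: extends_continuously_cst.
under eq_fun do rewrite big_cons.
by case: (P i) => //; exact: extends_continuouslyD.
Qed.

Lemma extends_continuouslyT f :
  extends_continuously setT f <-> continuous f.
Proof.
rewrite /extends_continuously closureT; split => [[h ch hf]|cf].
  have -> : f = h by apply/funext => x; rewrite hf.
  by apply/continuous_subspace_setT.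
by exists f => //; exact: continuous_subspaceT.
Qed.

Section integral_on.
Variable Omega : set 'rV[R]_d.
Hypotheses (oOmega : open Omega) (bOmega : bounded_set Omega).
Let mOmega : measurable (vec @^-1` Omega : set (d.-tuple (measurableTypeR R))).
Proof. exact: measurable_preimage_vec_open. Qed.

Let sub_cube : exists M : R, forall x, Omega x -> forall i, `|x 0 i| <= M.
Proof.
have [M [Mr OM]] := bOmega; exists (M + 1) => x Ox i.
by rewrite (le_trans (row_coord_le_norm _ _))// OM// ltrDl.
Qed.

Let cube M : set 'rV[R]_d := [set x | forall i, x 0 i \in `[(- M), M]].

Let compact_closure : compact (closure Omega).
Proof.
have [M OM] := sub_cube.
have cc : compact (cube M).
  apply: (@rV_compact _ _ (fun=> `[(- M), M]%classic)) => i.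
  exact: segment_compact.
apply: (subclosed_compact _ cc); first exact: closed_closure.
have /closure_id -> : closed (cube M).
  exact: (compact_closed (@norm_hausdorff _ _) cc).
apply: closureS => x /OM xM i.
by rewrite in_itv/= -ler_norml.
Qed.

Lemma volume_lty : (lebesgue_tuple d (vec @^-1` Omega) < +oo)%E.
Proof.
have [M OM] := sub_cube.
apply: (@le_lt_trans _ _ (lebesgue_tuple d
    [set u | forall i, `[(- M), M]%classic (tnth u i)])).
  apply: le_measure; rewrite ?inE//.
    exact: (@measurable_coord_box _ _ (fun=> `[(- M), M]%classic)).
  move=> u /= /OM uM i; have := uM i.
  by rewrite mxE ler_norml in_itv.
rewrite (@lebesgue_tuple_box _ _ (fun=> `[(- M), M]%classic))// ltey_eq.
apply/orP; left.
apply: (big_ind (fun z : \bar R => z \is a fin_num)) => // [x y|i _].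
  exact: fin_numM.
by rewrite /= lebesgue_measure_itv/=; case: ifPn.
Qed.

(** The extension is bounded on the closure, which is compact, and [Omega] has
    finite volume. *)
Lemma integrable_extends_continuously f : extends_continuously Omega f ->
  (lebesgue_tuple d).-integrable (vec @^-1` Omega) (EFin \o (f \o vec)).
Proof.
move=> [h ch hf].
apply: (@eq_integrable _ _ _ _ _ _ (EFin \o (h \o vec))) => //.
  by move=> u; rewrite inE/= => Ou; rewrite hf.
apply: measurable_bounded_integrable => //.
- exact: volume_lty.
- apply: measurable_fun_vec => //.
  by apply: continuous_subspaceW ch; exact: subset_closure.
have /compact_bounded[M [_ mrt]] := continuous_compact ch compact_closure.
exists M; split; rewrite ?num_real // => r Mr u Ou; apply: mrt => //=.
by exists (vec u) => //; exact: subset_closure.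
Qed.

End integral_on.
End continuous_extension.

(** * Periodic functions on a box *)
Section affine_slice.
Context {R : realType}.

(** Restricts a directional derivative to a slice, [L] being the embedding of
    the slice. *)
Lemma is_derive_affine (V W : normedModType R) (L : V -> W) (F : W -> R)
    (y e : V) (e' : W) (g : R) :
  (forall h : R, L (h *: e + y) = h *: e' + L y) ->
  is_derive (L y) e' F g -> is_derive y e (F \o L) g.
Proof.
move=> Lh [dF gE].
have E : (fun h : R => h^-1 *: (((F \o L) \o shift y) (h *: e) - (F \o L) y)) =
         (fun h : R => h^-1 *: ((F \o shift (L y)) (h *: e') - F (L y))).
  by apply/funext => h /=; rewrite Lh.
by split; [rewrite /derivable E | rewrite /derive E].
Qed.

(** The map [cons_tup] read through [vec]. *)
Definition row_cons d (x : R) (y : 'rV[R]_d) : 'rV[R]_d.+1 :=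
  \row_k (if unlift ord0 k is Some j then y 0 j else x).

Lemma row_cons0 d x (y : 'rV[R]_d) : row_cons x y 0 ord0 = x.
Proof. by rewrite mxE unlift_none. Qed.

Lemma row_consS d x (y : 'rV[R]_d) j : row_cons x y 0 (lift ord0 j) = y 0 j.
Proof. by rewrite mxE liftK. Qed.

Lemma row_consP d (u v : 'rV[R]_d.+1) :
  u 0 ord0 = v 0 ord0 -> (forall j, u 0 (lift ord0 j) = v 0 (lift ord0 j)) ->
  u = v.
Proof.
move=> h0 hS; apply/rowP => k.
by case: (unliftP ord0 k) => [j ->|->].
Qed.

Lemma vec_cons_tup d (x : R) (u : d.-tuple (measurableTypeR R)) :
  vec (cons_tup (x, u)) = row_cons x (vec u).
Proof.
apply: row_consP; first by rewrite row_cons0 mxE.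
by move=> j; rewrite row_consS !mxE tnthS.
Qed.

Lemma row_cons_addl d (x h : R) (y : 'rV[R]_d) :
  row_cons (h *: 1 + x) y = h *: delta_mx 0 ord0 + row_cons x y.
Proof.
apply: row_consP => [|j]; rewrite !mxE ?unlift_none ?liftK /=.
  by [].

by rewrite mulr0 add0r.
Qed.

Lemma row_cons_addr d (x h : R) (y : 'rV[R]_d) j :
  row_cons x (h *: delta_mx 0 j + y) =
  h *: delta_mx 0 (lift ord0 j) + row_cons x y.
Proof.
apply: row_consP => [|k]; rewrite !mxE ?unlift_none ?liftK /=.
  by rewrite mulr0 add0r.
by rewrite !mxE (inj_eq lift_inj).
Qed.

Lemma row_cons_continuousl d (y : 'rV[R]_d) : continuous (fun x : R => row_cons x y).
Proof.
move=> x; apply/cvg_ballP => e e0; near=> z; split => // i j.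
rewrite (ord1 i); case: (unliftP ord0 j) => [k ->|->].
  by rewrite !row_consS; exact: ballxx.
rewrite !row_cons0; near: z.
by have := nbhsx_ballx x e e0; apply: filterS.
Unshelve. all: by end_near. Qed.

Lemma row_cons_continuousr d (x : R) : continuous (@row_cons d x).
Proof.
move=> y A /nbhs_ballP[e /= e0 eA]; apply/nbhs_ballP; exists e => // z [_ yz].
apply: eA; split => // i j.
rewrite (ord1 i); case: (unliftP ord0 j) => [k ->|->].
  by rewrite !row_consS; exact: yz.
by rewrite !row_cons0; exact: ballxx.
Qed.

End affine_slice.

Section periodic_box.
Context {R : realType}.
Local Notation leb := (@lebesgue_measure R).

Lemma open_box_open d (a b : 'rV[R]_d) : open (open_box a b).
Proof.
rewrite openE => x xab.
apply: (@filter_forall _ _ (fun i y => a 0 i < y 0 i < b 0 i) (nbhs x)) => i.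
have /andP[ax xb] := xab i.
have cx : y 0 i @[y --> x] --> x 0 i := @coord_continuous _ _ _ 0 i x.
near=> y; apply/andP; split; near: y.
  by move/cvgr_gt : cx; apply.
by move/cvgr_lt : cx; apply.
Unshelve. all: by end_near. Qed.

Lemma open_box_bounded d (a b : 'rV[R]_d) : bounded_set (open_box a b).
Proof.
pose M := \sum_i (`|a 0 i| + `|b 0 i|); exists M; split; first exact: num_real.
move=> r Mr x xab; rewrite /= (le_trans _ (ltW Mr))//.
have M0 : 0 <= M by apply: sumr_ge0 => i _; rewrite addr_ge0.
rewrite /Num.norm/= mx_normrE; apply/bigmax_leP; split => // -[i j] _ /=.
rewrite (ord1 i) (le_trans (_ : _ <= `|a 0 j| + `|b 0 j|))//.
  have /andP[ax xb] := xab j; rewrite ler_norml.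
  have := ler_norm (b 0 j); have := ler_norm (- a 0 j); rewrite normrN.
  have := normr_ge0 (a 0 j); have := normr_ge0 (b 0 j).
  by move=> *; apply/andP; split; lra.
by rewrite /M (bigD1 j)//= lerDl sumr_ge0// => k _; rewrite addr_ge0.
Qed.

Definition row_tail d (a : 'rV[R]_d.+1) : 'rV[R]_d := \row_j a 0 (lift ord0 j).

Lemma open_box_row_cons d (a b : 'rV[R]_d.+1) x y :
  open_box a b (row_cons x y) <->
  a 0 ord0 < x < b 0 ord0 /\ open_box (row_tail a) (row_tail b) y.
Proof.
split=> [h|[h0 hS] k].
  split => [|j]; first by have := h ord0; rewrite row_cons0.
  by have := h (lift ord0 j); rewrite row_consS !mxE.
case: (unliftP ord0 k) => [j ->|->]; last by rewrite row_cons0.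
by have := hS j; rewrite row_consS !mxE.
Qed.

Section slicing.
Variables (d : nat) (a b : 'rV[R]_d.+1) (G : 'rV[R]_d.+1 -> R).
Hypothesis cG : continuous G.
Local Notation T := (d.-tuple (measurableTypeR R)).
Local Notation m := (lebesgue_tuple d).

Let D : set (d.+1.-tuple (measurableTypeR R)) := vec @^-1` open_box a b.
Let mD : measurable D.
Proof. by apply: measurable_preimage_vec_open; exact: open_box_open. Qed.
Let g : measurableTypeR R * T -> \bar R :=
  (EFin \o (G \o vec) \o @cons_tup R d) \_ (@cons_tup R d @^-1` D).

Let mG : measurable_fun setT
  (EFin \o (G \o vec) : d.+1.-tuple (measurableTypeR R) -> \bar R).
Proof.
apply/measurable_EFinP.
have mT : measurable
    (vec @^-1` [set: 'rV[R]_d.+1] : set (d.+1.-tuple (measurableTypeR R))).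
  by rewrite preimage_setT.
have := @measurable_fun_vec R _ _ G mT (continuous_subspaceT cG).
by rewrite preimage_setT.
Qed.

Let mcD : measurable (@cons_tup R d @^-1` D).
Proof.
by rewrite -[X in measurable X]setTI; exact: measurable_cons_tup.
Qed.

Let integrable_cons : (leb \x m)%E.-integrable (@cons_tup R d @^-1` D)
  (EFin \o (G \o vec) \o @cons_tup R d).
Proof.
have : (lebesgue_tuple d.+1).-integrable D (EFin \o (G \o vec)).
  apply: integrable_extends_continuously.
  - exact: open_box_open.
  - exact: open_box_bounded.
  - by exists G => //; exact: continuous_subspaceT.
move=> /integrableP[_ h]; apply/integrableP; split.
  by apply: measurable_funTS; apply: measurableT_comp => //; exact: measurable_cons_tup.
apply: le_lt_trans h.
(* [lebesgue_tuple d.+1] is by definition an image measure. *)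
change (\int[(leb \x m)]_(p in @cons_tup R d @^-1` D)
    `|(EFin \o (G \o vec) \o @cons_tup R d) p| <=
  \int[pushforward (leb \x m) (@cons_tup R d)]_(u in D)
    `|(EFin \o (G \o vec)) u|)%E.
rewrite ge0_integral_pushforward//; first exact: measurable_cons_tup.
by apply: measurable_funTS; exact: measurableT_comp.
Qed.

Let integrable_g : (leb \x m)%E.-integrable setT g.
Proof. by rewrite /g -integrable_mkcond. Qed.

Let integral_onE : integral_on (open_box a b) G =
  fine (\int[(leb \x m)%E]_p g p)%E.
Proof.
rewrite /integral_on /Rintegral; congr fine.
rewrite -integral_mkcond.
change (\int[pushforward (leb \x m) (@cons_tup R d)]_(u in D)
    (EFin \o (G \o vec)) u =
  \int[(leb \x m)]_(p in @cons_tup R d @^-1` D)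
    (EFin \o (G \o vec) \o @cons_tup R d) p)%E.
by rewrite integral_pushforward//; exact: measurable_cons_tup.
Qed.

Let gE x u : g (x, u) =
  if (a 0 ord0 < x < b 0 ord0) && `[< open_box (row_tail a) (row_tail b) (vec u) >]
  then (G (row_cons x (vec u)))%:E else 0%E.
Proof.
rewrite /g patchE; have -> : ((x, u) \in @cons_tup R d @^-1` D) =
    (a 0 ord0 < x < b 0 ord0) && `[< open_box (row_tail a) (row_tail b) (vec u) >].
  apply/idP/idP; rewrite inE /D /= vec_cons_tup.
    by move/open_box_row_cons => [-> ?]; apply/asboolP.
  by move=> /andP[h /asboolP h']; apply/open_box_row_cons.
by case: ifPn => // _; rewrite /= vec_cons_tup.
Qed.

(** Fubini's theorem, integrating the first coordinate last. *)
Lemma integral_on_slice_tail_eq0 :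
  (forall x, integral_on (open_box (row_tail a) (row_tail b))
               (fun y => G (row_cons x y)) = 0) ->
  integral_on (open_box a b) G = 0.
Proof.
move=> h; rewrite integral_onE -integral12_prod_meas1//= integral0_eq// => x _.
rewrite /fubini_F.
have [xab|xab] := boolP (a 0 ord0 < x < b 0 ord0); last first.
  by rewrite integral0_eq// => u _; rewrite gE (negbTE xab).
transitivity (\int[m]_(u in vec @^-1` open_box (row_tail a) (row_tail b))
    (EFin \o ((fun y => G (row_cons x y)) \o vec)) u)%E.
  rewrite [RHS]integral_mkcond; apply: eq_integral => u _.
  by rewrite gE xab patchE /=; congr (if _ then _ else _); rewrite mem_setE.
rewrite -[LHS]fineK; first by congr EFin; exact: h.
apply: integrable_fin_num.
  by apply: measurable_preimage_vec_open; exact: open_box_open.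
apply: integrable_extends_continuously.
- exact: open_box_open.
- exact: open_box_bounded.
- exists (fun y => G (row_cons x y)) => //; apply: continuous_subspaceT => y.
  apply: continuous_comp; last exact: cG.
  exact: row_cons_continuousr.
Qed.

(** Fubini's theorem, integrating the first coordinate first. *)
Lemma integral_on_slice_head_eq0 :
  (forall y,
    \int[leb]_(x in `]a 0%R ord0, b 0%R ord0[) (G (row_cons x y))%:E = 0)%E ->
  integral_on (open_box a b) G = 0.
Proof.
move=> h; rewrite integral_onE -integral21_prod_meas1//= integral0_eq// => u _.
rewrite /fubini_G.
have [uab|uab] := boolP `[< open_box (row_tail a) (row_tail b) (vec u) >]; last first.
  by rewrite integral0_eq// => x _; rewrite gE (negbTE uab) andbF.
rewrite -(h (vec u)) [RHS]integral_mkcond; apply: eq_integral => x _.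
by rewrite gE uab andbT patchE mem_setE /= in_itv.
Qed.

End slicing.

(** Along the [i]-th coordinate the fundamental theorem of calculus gives the
    difference of the values of [F] on two opposite faces, which agree by
    periodicity.  The induction on the dimension freezes the first coordinate
    until the [i]-th one comes first. *)
Lemma integral_box_partial d (a b : 'rV[R]_d) (i : 'I_d) (F G : 'rV[R]_d -> R) :
  (forall j, a 0 j < b 0 j) ->
  continuous G -> (forall x, is_derive x (delta_mx 0 i) F (G x)) ->
  (forall x, F (x + (b 0 i - a 0 i) *: delta_mx 0 i) = F x) ->
  integral_on (open_box a b) G = 0.
Proof.
elim: d a b i F G => [a b []//|d ih] a b i F G ab cG dF Fper.
case: (unliftP ord0 i) => [j ij|i0]; subst i.
  apply: integral_on_slice_tail_eq0 => // x.
  apply: (ih _ _ j (F \o row_cons x)).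
  - by move=> k; rewrite !mxE.
  - move=> y; apply: continuous_comp; last exact: cG.
    exact: row_cons_continuousr.
  - move=> y; apply: is_derive_affine (dF _) => h.
    exact: row_cons_addr.
  - move=> y /=; rewrite addrC row_cons_addr addrC !mxE.
    exact: Fper.
apply: integral_on_slice_head_eq0 => // y.
have dFy (x : R) : is_derive x 1 (fun x => F (row_cons x y)) (G (row_cons x y)).
  apply: (@is_derive_affine R R^o _ (fun x => row_cons x y) F _ _ _ _ _ (dF _)) => h.
  exact: row_cons_addl.
have cGy : continuous (fun x : R => G (row_cons x y)).
  move=> x; apply: continuous_comp; last exact: cG.
  exact: row_cons_continuousl.
rewrite -(@integral_itv_bndoo _ _ _ _ true false); last first.
  by apply: measurable_funTS; apply/measurable_EFinP; exact: continuous_measurable_fun.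
have cFy : continuous (fun x : R => F (row_cons x y)).
  by move=> x; apply/differentiable_continuous/derivable1_diffP; case: (dFy x).
rewrite (@continuous_FTC2 _ _ (fun x : R => F (row_cons x y)))//.
- rewrite -EFinB; congr EFin; apply/eqP; rewrite subr_eq0; apply/eqP.
  rewrite -(Fper (row_cons (a 0 ord0) y)) addrC -row_cons_addl.
  congr (F (row_cons _ y)).
  by rewrite /GRing.scale/= mulr1 subrK.
- exact: continuous_subspaceT.
- split => [x _||]; first by case: (dFy x).
  + by apply: cvg_at_right_filter; exact: cFy.
  + by apply: cvg_at_left_filter; exact: cFy.
- by move=> x _; rewrite derive1E; case: (dFy x).
Qed.
End periodic_box.

(** * Green's formula *)
Section C1_functions.
Context {R : realType} {d : nat}.
Variable Omega : set 'rV[R]_d.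
Hypothesis oOmega : open Omega.
Implicit Types (f g u v : 'rV[R]_d -> R).

Lemma eq_partial f g i x : (forall x, Omega x -> f x = g x) -> Omega x ->
  partial i f x = partial i g x.
Proof.
move=> fg Ox; apply: near_eq_derive.
by apply: filterS fg _; exact: open_nbhs_nbhs.
Qed.

Lemma eq_C1_closure f g : (forall x, Omega x -> f x = g x) ->
  C1_closure Omega f -> C1_closure Omega g.
Proof.
move=> fg [ef df]; split; first exact: eq_extends_continuously ef.
move=> i; have [dfi edf] := df i; split => [x Ox|].
  apply: near_eq_derivable (dfi _ Ox).
  by apply: filterS fg _; exact: open_nbhs_nbhs.
by apply: eq_extends_continuously edf => x; exact: eq_partial.
Qed.

Lemma partialM f g i x :
  derivable f x (delta_mx 0 i) -> derivable g x (delta_mx 0 i) ->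
  partial i (fun y => f y * g y) x =
  f x * partial i g x + g x * partial i f x.
Proof. by move=> df dg; rewrite /partial (deriveM df dg). Qed.

Lemma C1_closureM f g : C1_closure Omega f -> C1_closure Omega g ->
  C1_closure Omega (fun x => f x * g x).
Proof.
move=> [ef df] [eg dg]; split; first exact: extends_continuouslyM.
move=> i; have [dfi edf] := df i; have [dgi edg] := dg i.
split => [x Ox|]; first by apply: derivableM; [exact: dfi|exact: dgi].
apply: (@eq_extends_continuously _ _ _
    (fun x => f x * partial i g x + g x * partial i f x)).
  by move=> x Ox; rewrite partialM//; [exact: dfi|exact: dgi].
by apply: extends_continuouslyD; exact: extends_continuouslyM.
Qed.

End C1_functions.

Section green.
Context {R : realType} {d : nat}.
Implicit Types (Omega : set 'rV[R]_d) (u v : 'rV[R]_d -> R).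

Lemma measurable_boundary Omega : open Omega ->
  measurable (vec @^-1` boundary Omega : set (d.-tuple (measurableTypeR R))).
Proof.
move=> oO; apply: measurableD; last exact: measurable_preimage_vec_open.
rewrite -[X in measurable X]setCK; apply: measurableC.
rewrite (_ : ~` _ = vec @^-1` (~` closure Omega))//.
apply: measurable_preimage_vec_open.
by apply: closed_openC; exact: closed_closure.
Qed.

(** The divergence theorem for the field [v grad u], its components being
    replaced by their continuous extensions to the closure.  At a boundary point
    the normal component of the extended field is [v] times the limit from
    inside of the derivative of [u] along [nu], that is, zero. *)
Lemma integral_div_neumann Omega sigma nu v u : open Omega ->
  surface_measure_normal Omega sigma nu ->
  C1_closure Omega v -> C2_closure Omega u ->
  {ae sigma, forall w, boundary Omega (vec w) ->
                       normal_derivative_is0 Omega nu u (vec w)} ->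
  integral_on Omega
    (fun x => \sum_i partial i (fun y => v y * partial i u y) x) = 0.
Proof.
move=> oO [mnu _ div] C1v [C1u C1du] nu0.
have [[hv chv hvE] _] := C1v.
have ext_du i : exists h : 'rV[R]_d -> R, {within closure Omega, continuous h} /\
    forall x, Omega x -> h x = partial i u x.
  by have [[h ch hE] _] := C1du i; exists h.
pose k i := projT1 (cid (ext_du i)).
have ck i : {within closure Omega, continuous k i} by rewrite /k; case: cid => h [].
have kE i x : Omega x -> k i x = partial i u x.
  by rewrite /k; case: cid => h [_ hE] /=; exact: hE.
pose F i x := hv x * k i x.
have cF i : {within closure Omega, continuous F i}.
  by move=> x; apply: cvgM; [exact: chv|exact: ck].
have FE i x : Omega x -> v x * partial i u x = F i x.
  by move=> Ox; rewrite /F hvE// kE.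
have C1F i : C1_closure Omega (F i).
  by apply: (eq_C1_closure oO (FE i)); exact: C1_closureM.
transitivity (integral_on Omega (fun x => \sum_i partial i (F i) x)).
  apply: eq_Rintegral => w; rewrite inE/= => Ow; apply: eq_bigr => i _.
  exact: (eq_partial oO i (FE i) Ow).
rewrite div//.
have bc : boundary Omega `<=` closure Omega by move=> x [].
have mb := measurable_boundary oO.
rewrite /Rintegral (@ae_eq_integral _ _ _ sigma _ (cst 0%E))//.
- by rewrite integral0.
- apply/measurable_EFinP; apply: measurable_sum => i; apply: measurable_funM.
    by apply: (measurable_fun_vec mb); exact: continuous_subspaceW (cF i).
  exact: mnu.
apply: filterS nu0 => w nw /= bw; congr EFin.
have [cw nOw] := bw.
have pr : ProperFilter (within Omega (nbhs (vec w))) by exact: within_nbhs_proper.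
have lim0 := nw bw.
have limk : (fun y => \sum_i partial i u y * nu (vec w) 0 i)
    @ within Omega (nbhs (vec w)) --> \sum_i k i (vec w) * nu (vec w) 0 i.
  apply: (@cvg_trans _
    ((fun y => \sum_i k i y * nu (vec w) 0 i) @ within Omega (nbhs (vec w)))).
    apply: near_eq_cvg; near=> y; apply: eq_bigr => i _; rewrite kE//.
    by near: y; exact: withinT.
  apply: cvg_big => [|i _]; first exact: add_continuous.
   apply: cvgMr_tmp.
  have /subspace_continuousP/(_ _ cw) := ck i.
  by apply: cvg_trans; apply: cvg_app; apply: within_subset; exact: subset_closure.
(* A boundary point lies in the closure, so limits from inside are unique. *)
have E : \sum_i k i (vec w) * nu (vec w) 0 i = 0.
  exact: cvg_unique limk lim0.
under eq_bigr do rewrite /F -mulrA.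
by rewrite -mulr_sumr E mulr0.
Unshelve. all: by end_near. Qed.

Lemma partial_shift u i (c : 'rV[R]_d) x :
  partial i (fun y => u (y + c)) x = partial i u (x + c).
Proof.
rewrite /partial /derive.
have -> : (fun h : R => h^-1 *: (((fun y => u (y + c)) \o shift x)
             (h *: delta_mx 0 i) - u (x + c))) =
          (fun h : R => h^-1 *: ((u \o shift (x + c))
             (h *: delta_mx 0 i) - u (x + c))).
  by apply/funext => h /=; rewrite addrA.
by [].
Qed.

(** Each component [v * partial i u] is itself periodic. *)
Lemma integral_div_periodic (a b : 'rV[R]_d) v u :
  (forall i, a 0 i < b 0 i) ->
  C1_closure setT v -> C2_closure setT u ->
  box_periodic a b v -> box_periodic a b u ->
  integral_on (open_box a b)
    (fun x => \sum_i partial i (fun y => v y * partial i u y) x) = 0.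
Proof.
move=> ab C1v [C1u C1du] pv pu.
have C1F i : C1_closure setT (fun y => v y * partial i u y) by exact: C1_closureM.
have cF i : continuous (partial i (fun y => v y * partial i u y)).
  by apply/extends_continuouslyT; have [_ /(_ i)[]] := C1F i.
have oO : open (open_box a b) by exact: open_box_open.
have bO : bounded_set (open_box a b) by exact: open_box_bounded.
have mO : measurable (vec @^-1` open_box a b : set (d.-tuple (measurableTypeR R))).
  exact: measurable_preimage_vec_open.
rewrite /integral_on (Rintegral_sum mO); last first.
  move=> i; apply: (integrable_extends_continuously oO bO).
  exists (partial i (fun y => v y * partial i u y)) => //.
  exact: continuous_subspaceT.
rewrite big1// => i _.
apply: (@integral_box_partial _ _ a b i (fun y => v y * partial i u y)) => //.
  by move=> x; split => //; have [_ /(_ i)[dF _]] := C1F i; exact: dF.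
move=> x; rewrite pv; congr (_ * _).
have uE : (fun y => u (y + (b 0 i - a 0 i) *: delta_mx 0 i)) = u.
  by apply/funext => y; exact: pu.
by have := partial_shift u i ((b 0 i - a 0 i) *: delta_mx 0 i) x; rewrite uE.
Qed.

(** The product rule applied to the divergence of [v grad u]. *)
Lemma green_identity Omega v u : open Omega -> bounded_set Omega ->
  C1_closure Omega v -> C2_closure Omega u ->
  integral_on Omega
    (fun x => \sum_i partial i (fun y => v y * partial i u y) x) = 0 ->
  integral_on Omega (fun x => v x * laplacian u x) =
  - integral_on Omega (fun x => \sum_i partial i v x * partial i u x).
Proof.
move=> oO bO [ev dv] [[_ du] C1du] div0.
have mO : measurable (vec @^-1` Omega : set (d.-tuple (measurableTypeR R))).
  exact: measurable_preimage_vec_open.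
apply/eqP; rewrite -subr_eq0 opprK; apply/eqP; rewrite -[RHS]div0.
have e1 : extends_continuously Omega (fun x => v x * laplacian u x).
  apply: extends_continuouslyM => //; apply: extends_continuously_sum => i.
  by have [_ /(_ i)[]] := C1du i.
have e2 : extends_continuously Omega
    (fun x => \sum_i partial i v x * partial i u x).
  apply: extends_continuously_sum => i; apply: extends_continuouslyM.
    by have [] := dv i.
  by have [] := du i.
have i1 := integrable_extends_continuously oO bO e1.
have i2 := integrable_extends_continuously oO bO e2.
rewrite /integral_on -(RintegralD mO)//.
apply: eq_Rintegral => w; rewrite inE/= => Ow.
rewrite /laplacian mulr_sumr -big_split/=; apply: eq_bigr => i _.
rewrite partialM; first by rewrite (mulrC (partial i u _)).
  by have [h _] := dv i; exact: h.
by have [_ /(_ i)[h _]] := C1du i; exact: h.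
Qed.
End green.

(** * Energy balance *)
Section energy_calculus.
Context {R : realType} {d : nat}.
Variable Omega : set 'rV[R]_d.
Hypotheses (oOmega : open Omega) (bOmega : bounded_set Omega).
Implicit Types (f g u v : 'rV[R]_d -> R).

Let mOmega : measurable (vec @^-1` Omega : set (d.-tuple (measurableTypeR R))).
Proof. exact: measurable_preimage_vec_open. Qed.

Lemma eq_integral_on f g :
  (forall x, Omega x -> f x = g x) -> integral_on Omega f = integral_on Omega g.
Proof. by move=> fg; apply: eq_Rintegral => w; rewrite inE/= => /fg. Qed.

Lemma integral_onD f g :
  extends_continuously Omega f -> extends_continuously Omega g ->
  integral_on Omega (fun x => f x + g x) =
  integral_on Omega f + integral_on Omega g.
Proof.
move=> ef eg.
have i1 := integrable_extends_continuously oOmega bOmega ef.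
have i2 := integrable_extends_continuously oOmega bOmega eg.
by rewrite /integral_on -(RintegralD mOmega).
Qed.

Lemma integral_onZ (c : R) f : extends_continuously Omega f ->
  integral_on Omega (fun x => c * f x) = c * integral_on Omega f.
Proof.
move=> ef; have i1 := integrable_extends_continuously oOmega bOmega ef.
by rewrite /integral_on -(RintegralZl _ mOmega).
Qed.

Lemma integral_onB f g :
  extends_continuously Omega f -> extends_continuously Omega g ->
  integral_on Omega (fun x => f x - g x) =
  integral_on Omega f - integral_on Omega g.
Proof.
move=> ef eg; rewrite integral_onD//; last exact: extends_continuouslyN.
congr (_ + _); rewrite -mulN1r -integral_onZ//.
by apply: eq_integral_on => x _; rewrite mulN1r.
Qed.

Lemma integral_on_cst (c : R) :
  integral_on Omega (fun=> c) = c * volume Omega.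
Proof. by rewrite /integral_on Rintegral_cst. Qed.

Lemma integral_on_sum n (F : nat -> 'rV[R]_d -> R) :
  (forall i, (i < n)%N -> extends_continuously Omega (F i)) ->
  extends_continuously Omega (fun x => \sum_(i < n) F i x) /\
  integral_on Omega (fun x => \sum_(i < n) F i x) =
  \sum_(i < n) integral_on Omega (F i).
Proof.
elim: n => [|n ih] eF.
  under eq_fun do rewrite big_ord0.
  split; first exact: extends_continuously_cst.
  by rewrite big_ord0 integral_on_cst mul0r.
have [e1 i1] := ih (fun i h => eF i (ltnW h)).
under eq_fun do rewrite big_ord_recr/=.
split; first by apply: extends_continuouslyD => //; exact: eF.
by rewrite big_ord_recr/= -i1 integral_onD//; exact: eF.
Qed.

Lemma partial_midpoint f g i x :
  derivable f x (delta_mx 0 i) -> derivable g x (delta_mx 0 i) ->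
  partial i (midpoint f g) x = midpoint (partial i f) (partial i g) x.
Proof.
move=> df dg; rewrite /partial /midpoint.
have -> : (fun x => (f x + g x) / 2) = 2^-1 \*: (f + g).
  by apply/funext => y; rewrite /= mulrC.
by rewrite deriveZ ?deriveD//; [rewrite /GRing.scale/= mulrC|exact: derivableD].
Qed.

Lemma laplacian_midpoint f g x : C2_closure Omega f -> C2_closure Omega g ->
  Omega x -> laplacian (midpoint f g) x = (laplacian f x + laplacian g x) / 2.
Proof.
move=> [[_ df] C1df] [[_ dg] C1dg] Ox.
rewrite /laplacian -big_split mulr_suml; apply: eq_bigr => i _ /=.
have [dfi _] := df i; have [dgi _] := dg i.
have [_ /(_ i)[ddfi _]] := C1df i; have [_ /(_ i)[ddgi _]] := C1dg i.
rewrite (eq_partial oOmega i (g := midpoint (partial i f) (partial i g)))//.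
  by rewrite partial_midpoint//; [exact: ddfi|exact: ddgi].
by move=> y Oy; rewrite partial_midpoint//; [exact: dfi|exact: dgi].
Qed.

Lemma extends_laplacian f : C2_closure Omega f ->
  extends_continuously Omega (laplacian f).
Proof.
move=> [_ C1df]; apply: extends_continuously_sum => i.
by have [_ /(_ i)[]] := C1df i.
Qed.

Lemma extends_grad f g : C1_closure Omega f -> C1_closure Omega g ->
  extends_continuously Omega (fun x => \sum_i partial i f x * partial i g x).
Proof.
move=> [_ df] [_ dg]; apply: extends_continuously_sum => i.
by apply: extends_continuouslyM; [have [] := df i|have [] := dg i].
Qed.

Lemma grad_sqrE u :
  grad_sqr u = fun x => \sum_i partial i u x * partial i u x.
Proof. by apply/funext => x; apply: eq_bigr => i _; rewrite expr2. Qed.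

Lemma extends_grad_sqr u : C2_closure Omega u ->
  extends_continuously Omega (grad_sqr u).
Proof. by move=> [C1u _]; rewrite grad_sqrE; exact: extends_grad. Qed.

Definition green_formula v u : Prop :=
  integral_on Omega (fun x => v x * laplacian u x) =
  - integral_on Omega (fun x => \sum_i partial i v x * partial i u x).

End energy_calculus.

Ltac extends := repeat first
  [ assumption | apply: extends_continuously_cst | apply: extends_laplacian
  | apply: extends_continuouslyD | apply: extends_continuouslyN
  | apply: extends_continuouslyX | apply: extends_continuouslyM ].

Section energy_increment.
Context {R : realType} {d : nat}.
Variable Omega : set 'rV[R]_d.
Hypotheses (oOmega : open Omega) (bOmega : bounded_set Omega).

Variables (eps S : R) (f f' r r' : 'rV[R]_d -> R).
Hypotheses (C2f : C2_closure Omega f) (C2f' : C2_closure Omega f').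
Hypotheses (er : extends_continuously Omega r)
  (er' : extends_continuously Omega r').
Hypotheses (gff : green_formula Omega f f) (gff' : green_formula Omega f f')
  (gf'f : green_formula Omega f' f) (gf'f' : green_formula Omega f' f').
Hypothesis relax :
  forall x, Omega x -> (r' x + r x) / 2 = f x ^+ 2 - 1 - S.

Let ef : extends_continuously Omega f. Proof. by case: C2f => -[]. Qed.
Let ef' : extends_continuously Omega f'. Proof. by case: C2f' => -[]. Qed.

(* The identities below are algebraic in these two quantities. *)
Local Opaque laplacian grad_sqr.

(** A difference of squares: the mixed terms cancel because the Dirichlet form
    is symmetric. *)
Lemma integral_laplacian_midpoint :
  integral_on Omega (fun x => laplacian (midpoint f' f) x * (f' x - f x)) =
  - 2^-1 * (integral_on Omega (grad_sqr f') - integral_on Omega (grad_sqr f)).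
Proof.
transitivity (integral_on Omega (fun x => 2^-1 *
   ((f' x * laplacian f' x + f' x * laplacian f x)
   - (f x * laplacian f' x + f x * laplacian f x)))).
  apply: eq_integral_on => x Ox; rewrite (laplacian_midpoint oOmega)//.
  by move: (laplacian f' x) (laplacian f x) => a b; ring.
rewrite integral_onZ//; last by extends.
rewrite integral_onB//; [|by extends..].
rewrite integral_onD//; [|by extends..].
rewrite integral_onD//; [|by extends..].
pose D u v := integral_on Omega (fun x => \sum_i partial i u x * partial i v x).
transitivity (2^-1 * (- D f' f' + - D f' f - (- D f f' + - D f f))).
  congr (_ * (_ + _ - (_ + _)));
    [exact: gf'f'|exact: gf'f|exact: gff'|exact: gff].
have -> : D f f' = D f' f.
  by apply: eq_integral_on => x _; apply: eq_bigr => i _; rewrite mulrC.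
have -> : integral_on Omega (grad_sqr f') = D f' f' by rewrite grad_sqrE.
have -> : integral_on Omega (grad_sqr f) = D f f by rewrite grad_sqrE.
by move: (D f' f') (D f' f) (D f f) => a b c; ring.
Qed.

(** Substituting [f ^+ 2 - 1 - S = (r' + r) / 2] in the difference of the
    potential densities produces [(r' - r) * (r' + r) / 4], which cancels
    against the difference of the terms [r ^+ 2 / 4]; what remains is
    [(r' + S) * (f' ^+ 2 - f ^+ 2) / 2]. *)
Lemma modified_energy_increment :
  modified_energy eps S Omega f' r' - modified_energy eps S Omega f r =
  integral_on Omega (fun x =>
    (- eps ^+ 2 * laplacian (midpoint f' f) x
     + (r' x + S) * midpoint f' f x) * (f' x - f x)).
Proof.
have eg := extends_grad_sqr C2f; have eg' := extends_grad_sqr C2f'.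
have el : extends_continuously Omega (laplacian (midpoint f' f)).
  apply: (@eq_extends_continuously _ _ _
    (fun x => (laplacian f' x + laplacian f x) / 2)).
    by move=> x Ox; rewrite (laplacian_midpoint oOmega).
  by extends.
rewrite /modified_energy opprD addrACA subrr addr0 -integral_onB//; [|by extends..].
transitivity (integral_on Omega (fun x =>
   eps ^+ 2 / 2 * (grad_sqr f' x - grad_sqr f x)
   + (r' x + S) * midpoint f' f x * (f' x - f x))).
  apply: eq_integral_on => x Ox; rewrite /midpoint.
  have -> : r x = 2 * (f x ^+ 2 - 1 - S) - r' x.
    by rewrite -(relax Ox); field.
  move: (grad_sqr f' x) (grad_sqr f x) (f' x) (f x) (r' x) => A B a b c.
  by field.
rewrite integral_onD//; [|rewrite /midpoint; by extends..].
rewrite integral_onZ//; last by extends.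
rewrite integral_onB//.
transitivity (integral_on Omega (fun x =>
   - eps ^+ 2 * (laplacian (midpoint f' f) x * (f' x - f x))
   + (r' x + S) * midpoint f' f x * (f' x - f x))); last first.
  by apply: eq_integral_on => x _; ring.
rewrite [RHS]integral_onD//; [|rewrite /midpoint; by extends..].
rewrite [X in _ = X + _]integral_onZ//; last by extends.
rewrite integral_laplacian_midpoint; congr (_ + _).
move: (integral_on Omega (grad_sqr f')) (integral_on Omega (grad_sqr f)).
by move=> A B; ring.
Qed.

End energy_increment.

(** With [q = f ^+ 2 - 1 - S], the potential part and the constant
    [S ^+ 2 / 4] add up to the square [(q + S) ^+ 2 / 4]. *)
Lemma modified_energy_relaxed (R : realType) d (Omega : set 'rV[R]_d)
    (eps S : R) (f r : 'rV[R]_d -> R) :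
  open Omega -> bounded_set Omega -> C2_closure Omega f ->
  (forall x, Omega x -> r x = f x ^+ 2 - 1 - S) ->
  modified_energy eps S Omega f r = energy eps Omega f.
Proof.
move=> oO bO C2f rE; rewrite /modified_energy /energy.
have ef : extends_continuously Omega f by case: C2f => -[].
have eg : extends_continuously Omega (grad_sqr f).
  exact: extends_grad_sqr.
have er : extends_continuously Omega r.
  apply: (@eq_extends_continuously _ _ _ (fun x => f x ^+ 2 - 1 - S)).
    by move=> x Ox; rewrite rE.
  by extends.
rewrite -integral_on_cst// -integral_onD//; [|by extends..].
apply: eq_integral_on => x Ox; rewrite rE//.
by move: (grad_sqr f x) (f x) => A a; field.
Qed.

Lemma C1_closureS (R : realType) d (A B : set 'rV[R]_d) f :
  A `<=` B -> C1_closure B f -> C1_closure A f.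
Proof.
move=> AB; have extS g : extends_continuously B g -> extends_continuously A g.
  move=> [h ch hg]; exists h; last by move=> x /AB; exact: hg.
  by apply: continuous_subspaceW ch; exact: closureS.
move=> [ef df]; split; first exact: extS.
by move=> i; have [dfi edf] := df i; split; [move=> x /AB; exact: dfi|exact: extS].
Qed.

Lemma C2_closureS (R : realType) d (A B : set 'rV[R]_d) f :
  A `<=` B -> C2_closure B f -> C2_closure A f.
Proof.
move=> AB [C1f C1df]; split; first exact: C1_closureS C1f.
by move=> i; exact: C1_closureS (C1df i).
Qed.

Lemma green_of_bc (R : realType) d (Omega : set 'rV[R]_d) N
    (phi : nat -> 'rV[R]_d -> R) :
  open Omega -> bounded_set Omega ->
  periodic_bc Omega N phi \/ neumann_bc Omega N phi ->
  (forall n, (n <= N)%N -> C2_closure Omega (phi n)) /\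
  (forall m n, (m <= N)%N -> (n <= N)%N ->
     green_formula Omega (phi m) (phi n)).
Proof.
move=> oO bO [[a [b [ab OE pbc]]]|[sigma [nu [sn nbc]]]].
  have C2 n : (n <= N)%N -> C2_closure Omega (phi n).
    by move=> /pbc[h _]; exact: C2_closureS h.
  split => // m n mN nN; apply: green_identity => //; [by case: (C2 m mN)|exact: C2|].
  have [[C1m _] pm] := pbc m mN; have [C2n pn] := pbc n nN.
  by rewrite OE; exact: integral_div_periodic.
have C2 n : (n <= N)%N -> C2_closure Omega (phi n) by move=> /nbc[].
split => // m n mN nN; apply: green_identity => //; [by case: (C2 m mN)|exact: C2|].
apply: (integral_div_neumann oO sn); [by case: (C2 m mN)|exact: C2|].
by have [] := nbc n nN.
Qed.

Theorem theorem2p2 (R : realType) (d : nat) (hd : (0 < d)%N)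
  (Omega : set 'rV[R]_d) (hOmega : bounded_domain Omega)
  (alpha eps M S T : R) (halpha : 0 < alpha < 1)
  (heps : 0 < eps) (hM : 0 < M) (hS : 0 <= S)
  (N : nat) (t : nat -> R) (ht0 : t 0%N = 0)
  (htS : forall k, (k < N)%N -> t k < t k.+1) (htN : t N = T)
  (* [mu n] is mu^{n+1/2}; [r n] is r^{n-1/2}, so [r n.+1] is r^{n+1/2} *)
  (phi mu r : nat -> 'rV[R]_d -> R)
  (hbc : periodic_bc Omega N phi \/ neumann_bc Omega N phi)
  (hr0 : forall x, Omega x -> r 0%N x = phi 0%N x ^+ 2 - 1 - S)
  (hscheme : forall n, (n < N)%N -> forall x, Omega x ->
    [/\ L1plus_caputo alpha t (fun k => phi k x) n.+1 = - M * mu n x,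
        mu n x = - eps ^+ 2 * laplacian (midpoint (phi n.+1) (phi n)) x
                 + (r n.+1 x + S) * midpoint (phi n.+1) (phi n) x &
        (r n.+1 x + r n x) / 2 = phi n x ^+ 2 - 1 - S ]) :
  forall n, (n < N)%N ->
    modified_energy eps S Omega (phi n.+1) (r n.+1)
      <= modified_energy eps S Omega (phi 0%N) (r 0%N) /\
    modified_energy eps S Omega (phi 0%N) (r 0%N) = energy eps Omega (phi 0%N).
Proof.
move=> n nN.
have [oO _ _ bO] := hOmega.
have [C2 green] := green_of_bc oO bO hbc.
split; last by apply: modified_energy_relaxed => //; exact: C2.
have ephi k : (k <= N)%N -> extends_continuously Omega (phi k).
  by move=> /C2[[]].
have er k : (k <= N)%N -> extends_continuously Omega (r k).
  elim: k => [_|k ih kN].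
    apply: (@eq_extends_continuously _ _ _ (fun x => phi 0%N x ^+ 2 - 1 - S)).
      by move=> x Ox; rewrite hr0.
    by have e0 := ephi 0%N isT; extends.
  apply: (@eq_extends_continuously _ _ _
      (fun x => 2 * (phi k x ^+ 2 - 1 - S) - r k x)).
    by move=> x Ox; have [_ _ <-] := hscheme k kN x Ox; field.
  by have ek := ephi k (ltnW kN); have rk := ih (ltnW kN); extends.
pose P k x := mu k x * (phi k.+1 x - phi k x).
have emu k : (k < N)%N -> extends_continuously Omega (mu k).
  move=> kN; apply: (@eq_extends_continuously _ _ _
    (fun x => - eps ^+ 2 * ((laplacian (phi k.+1) x + laplacian (phi k) x) / 2)
              + (r k.+1 x + S) * midpoint (phi k.+1) (phi k) x)).
    move=> x Ox; have [_ -> _] := hscheme k kN x Ox.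
    by rewrite (laplacian_midpoint oO)//; apply: C2 => //; exact: ltnW.
  have C2k := C2 _ kN; have C2k' := C2 _ (ltnW kN); have erk := er _ kN.
  have ek := ephi _ kN; have ek' := ephi _ (ltnW kN).
  by rewrite /midpoint; extends.
have eP k : (k < N)%N -> extends_continuously Omega (P k).
  move=> kN; have ek := ephi _ kN; have ek' := ephi _ (ltnW kN).
  by have muk := emu _ kN; extends.
have incr k : (k < N)%N ->
    modified_energy eps S Omega (phi k.+1) (r k.+1)
    - modified_energy eps S Omega (phi k) (r k) = integral_on Omega (P k).
  move=> kN; have kN' := ltnW kN.
  rewrite modified_energy_increment//;
    try exact: C2; try exact: er; try exact: green.
    apply: eq_integral_on => x Ox; rewrite /P.
    by have [_ <- _] := hscheme k kN x Ox.
  by move=> x Ox; have [] := hscheme k kN x Ox.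
have [eQ iQ] := integral_on_sum oO bO
  (fun k (h : (k < n.+1)%N) => eP k (leq_trans h nN)).
rewrite -subr_le0.
have -> : modified_energy eps S Omega (phi n.+1) (r n.+1)
    - modified_energy eps S Omega (phi 0%N) (r 0%N) =
    integral_on Omega (fun x => \sum_(k < n.+1) P k x).
  rewrite iQ.
  rewrite -(telescope_sumr (fun k => modified_energy eps S Omega (phi k) (r k)))//.
  rewrite big_mkord; apply: eq_bigr => k _; apply: incr.
  exact: leq_trans nN.
rewrite -oppr_ge0 -mulN1r -integral_onZ//.
apply: Rintegral_ge0 => w /= Ow; set x := vec w.
(* The first equation of the scheme turns the dissipation into the form of the
   discrete Caputo derivative. *)
have -> : -1 * \sum_(k < n.+1) P k x = M^-1 * \sum_(k < n.+1)
    L1plus_caputo alpha t (fun k => phi k x) k.+1 * (phi k.+1 x - phi k x).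
  rewrite !mulr_sumr; apply: eq_bigr => k _.
  have kN : (k < N)%N by exact: leq_trans nN.
  have [-> _ _] := hscheme k kN x Ow.
  by rewrite /P; field; rewrite gt_eqF.
rewrite mulr_ge0 ?invr_ge0 ?(ltW hM)//.
exact: (L1plus_caputo_form_ge0 halpha htS (fun k => phi k x) nN).
Qed.
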